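(* Consider the linear system $x_{t+1}=\theta^* z_t+w_t$, $t\ge 0$, with $z_t=(x_t^\top,u_t^\top)^\top\in\mathbb{R}^{n_z}$, $n_z=n_x+n_u$, and $\theta^*\in\mathbb{R}^{n_x\times n_z}$, and suppose that Assumptions (A) (compactly and convexly supported i.i.d. noise), (B) (bounded $z_t$ and BMSB condition with constants $b_z,\sigma_z,p_z$) and (D) ($\epsilon$-slice partial-boundary-visiting noise, with boundary points $\mathcal{C}=\{c_1,\dots,c_\chi\}$, unit vectors $\mathcal{H}=\{h_1,\dots,h_\chi\}$ and function $p_w$), all spelled out in the context, hold. Let $a_1=\frac14\sigma_zp_z$, $a_2=\max\{1,\frac{64b_z^2}{\sigma_z^2p_z^2}\}$, $a_3=\frac18p_z^2$, let $\xi=\min_{\|x\|_2=1}\max_{h\in\mathcal{H}}h^\top x$ (the minimum being over unit vectors $x\in\mathbb{R}^{n_x}$), and let $a_5=\max\{1,\frac{4b_z}{a_1\xi}\}$. Then for all $T>m>0$ and every $\delta>0$, the membership set $\Theta_T=\bigcap_{t=0}^{T-1}\{\hat\theta\in\mathbb{R}^{n_x\times n_z}: x_{t+1}-\hat\theta z_t\in\mathbb{W}\}$ satisfies $$\mathbb{P}\left(\mathrm{diam}(\Theta_T)>\delta\right)\le \frac{T}{m}\,\tilde O(n_z^{5/2})\,a_2^{n_z}\exp(-a_3m)+\tilde O\left((n_xn_z)^{5/2}\right)a_5^{n_xn_z}\left[1-p_w\left(\tfrac{a_1\delta\xi}{4}\right)\right]^{\lceil T/m\rceil-1}.$$ The result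 remains true when the set $\mathcal{C}$ in Assumption (D) is infinite; when $\mathcal{H}$ is infinite, $\xi$ is defined by $\xi=\min_{\|x\|_2=1}\sup_{h\in\mathcal{H}}h^\top x$.
   Context: Setting: $x_t\in\mathbb{R}^{n_x}$ is the state, $u_t\in\mathbb{R}^{n_u}$ the control input, $w_t\in\mathbb{R}^{n_x}$ the process noise; $x_{t+1}=A^*x_t+B^*u_t+w_t$ and $\theta^*=(A^*,B^* )$ is the unknown parameter. $T$ (number of stages of data) and $m$ are integers. Let $\mathcal{F}_t=\sigma\{w_0,\dots,w_{t-1},z_0,\dots,z_t\}$. Diameter: for $\Theta\subseteq\mathbb{R}^{n_x\times n_z}$, $\mathrm{diam}(\Theta)=\sup_{\theta_1,\theta_2\in\Theta}\|\theta_1-\theta_2\|_F$, with $\|\cdot\|_F$ the Frobenius norm. Assumption (A): $\{w_t\}_{t\ge0}$ are identically and independently sampled from a known compact convex set $\mathbb{W}\subseteq\mathbb{R}^{n_x}$ with non-empty interior, $\mathbb{E}(w_t)=0$, and $\mathrm{Cov}(w_t)=\Sigma_w\succ0$. Assumption (B): there is $b_z$ with $\|z_t\|_2\le b_z$ almost surely for all $t\ge0$; and for some $\sigma_z>0$ and $p_z\in(0,1]$ the process $\{z_t\}$, adapted to $\{\mathcal{F}_t\}$, satisfies the $(1,\sigma_z^2\mathbb{I}_{n_z},p_z)$-block-martingale small-ball (BMSB) condition: for every fixed unit vector $\lambda\in\mathbb{R}^{n_z}$ and all $t\ge1$, $\mathbb{P}(|\lambda^\top z_{t+1}|\ge\sigma_z\mid\mathcal{F}_t)\ge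 p_z$ almost surely. Supporting half-spaces and slices: for $c\in\partial\mathbb{W}$ and a vector $h$ with $\|h\|_2=1$, the half-space $H(c,h)=\{x\in\mathbb{R}^{n_x}:h^\top x\ge h^\top c\}$ is a supporting half-space (SHS) of $\mathbb{W}$ at $c$ if $\mathbb{W}\subseteq H(c,h)$. For $\epsilon>0$ the $\epsilon$-slice of $\mathbb{W}$ induced by it is $S^\epsilon_{\mathbb{W}}(c,h)=\{x\in\mathbb{R}^{n_x}: h^\top c+\epsilon\ge h^\top x\ge h^\top c\}\cap\mathbb{W}$. Assumption (D): there exist boundary points $\mathcal{C}=\{c_1,\dots,c_\chi\}\subseteq\partial\mathbb{W}$ and unit vectors $\mathcal{H}=\{h_1,\dots,h_\chi\}$ such that (i) $H(c_i,h_i)$ is a SHS of $\mathbb{W}$ for every $i\in\{1,\dots,\chi\}$; (ii) $\bigcap_{i=1}^\chi H(c_i,h_i)$ is compact; (iii) for every $\epsilon>0$ there is $p_w(\epsilon)>0$ such that $\mathbb{P}(w_t\in S^\epsilon_{\mathbb{W}}(c_i,h_i))\ge p_w(\epsilon)$ for all $t\ge0$ and all $i\in\{1,\dots,\chi\}$. Notation: $\tilde O(\cdot)$ is big-O notation hiding logarithmic terms.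
   Formalization: The formal theorem additionally assumes that each noise w_t is independent of F_t (past noises and z_0,…,z_t); without this causality assumption the claim is false, e.g. for Rademacher noise with u_t = w_t and θ* = 0. *)

(* Defs.v *)
From HB Require Import structures.
From mathcomp Require Import all_boot all_order all_algebra.
From mathcomp Require Import all_classical all_reals all_analysis.
Set Implicit Arguments.
Unset Strict Implicit.
Unset Printing Implicit Defensive.
Import Order.TTheory GRing.Theory Num.Theory.
Import numFieldNormedType.Exports.
Local Open Scope classical_set_scope.
Local Open Scope ring_scope.

Section Euclidean.
Context {R : realType}.

(* Euclidean norm of a column vector (q = 1), Frobenius norm in general; the
   library norm `|A| is the max norm, which induces the same topology. *)
Definition norm2 (p q : nat) (A : 'M[R]_(p, q)) : R :=
  Num.sqrt (\sum_i \sum_j A i j ^+ 2).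

Definition dot (n : nat) (u v : 'cV[R]_n) : R := (u^T *m v) 0 0.

(* Extended-real valued: an unbounded set has diameter +oo (the real-valued
   [sup] would return 0). *)
Definition diam (p q : nat) (A : set 'M[R]_(p, q)) : \bar R :=
  ereal_sup [set (norm2 (th.1 - th.2))%:E | th in A `*` A].

Definition posdef (n : nat) (S : 'M[R]_n) : Prop :=
  S^T = S /\ forall v : 'cV[R]_n, v != 0 -> 0 < (v^T *m S *m v) 0 0.

Definition boundary (T : topologicalType) (A : set T) : set T :=
  closure A `\` interior A.

Definition halfspace (n : nat) (c h : 'cV[R]_n) : set 'cV[R]_n :=
  [set x | dot h c <= dot h x].

Definition supporting (n : nat) (W : set 'cV[R]_n) (c h : 'cV[R]_n) : Prop :=
  [/\ boundary W c, norm2 h = 1 & W `<=` halfspace c h].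

Definition slice (n : nat) (W : set 'cV[R]_n) (eps : R) (c h : 'cV[R]_n) :
    set 'cV[R]_n :=
  [set x | dot h c <= dot h x <= dot h c + eps] `&` W.

(* The outer infimum is attained: x |-> sup_i (h_i . x) is Lipschitz on the
   compact unit sphere when the h_i are unit vectors.  For a finite family the
   inner supremum is a maximum. *)
Definition minmax_dot (n : nat) (I : Type) (h : I -> 'cV[R]_n) : R :=
  inf [set sup [set dot (h i) x | i in [set: I]] | x in [set x | norm2 x = 1]].

(* f(n) = O~(g(n)) as n -> oo: big-O up to a power of log n. *)
Definition soft_bigO (f g : nat -> R) : Prop :=
  exists k : nat, f =O_\oo (fun n : nat => g n * ln (n%:R : R) ^+ k).

End Euclidean.

Section Probability.
Context {R : realType} {d : measure_display} {Omega : measurableType d}.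
Variable P : probability Omega R.

Definition borel (n : nat) : set (set 'cV[R]_n) := <<s @open 'cV[R]_n >>.

Definition random_vector (n : nat) (X : Omega -> 'cV[R]_n) : Prop :=
  forall B, borel B -> measurable (X @^-1` B).

Definition sigma_of (n : nat) (X : Omega -> 'cV[R]_n) : set (set Omega) :=
  preimage_set_system setT X (@borel n).

Definition independent_sigma (F G : set (set Omega)) : Prop :=
  forall A B, F A -> G B -> (P (A `&` B) = P A * P B)%E.

Definition mutually_independent (n : nat) (X : nat -> Omega -> 'cV[R]_n) :
    Prop :=
  forall (J : seq nat) (E : nat -> set Omega), uniq J ->
    (forall t, sigma_of (X t) (E t)) ->
    (P (\big[setI/setT]_(t <- J) E t) = \prod_(t <- J) P (E t))%E.

Definition identically_distributed (n : nat) (X : nat -> Omega -> 'cV[R]_n) :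
    Prop :=
  forall t B, borel B -> P (X t @^-1` B) = P (X 0%N @^-1` B).

(* Y is a version of the conditional probability P(E | G). *)
Definition is_cond_prob (G : set (set Omega)) (E : set Omega) (Y : Omega -> R) :
    Prop :=
  [/\ forall B : set R, measurable B -> G (Y @^-1` B),
      P.-integrable setT (EFin \o Y)
    & forall A, G A -> (\int[P]_(om in A) (Y om)%:E = P (A `&` E))%E].

(* F_t = sigma(w_0, ..., w_(t-1), z_0, ..., z_t). *)
Definition filtration (nx nz : nat) (w : nat -> Omega -> 'cV[R]_nx)
    (z : nat -> Omega -> 'cV[R]_nz) (t : nat) : set (set Omega) :=
  <<s (\bigcup_(s in [set s | (s < t)%N]) sigma_of (w s)) `|`
      (\bigcup_(s in [set s | (s <= t)%N]) sigma_of (z s)) >>.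

(* (1, sigma^2 Id, p)-block-martingale small-ball condition; z is adapted to
   [filtration w z] by construction. *)
Definition BMSB (nx nz : nat) (w : nat -> Omega -> 'cV[R]_nx)
    (z : nat -> Omega -> 'cV[R]_nz) (sigma p : R) : Prop :=
  forall lam : 'cV[R]_nz, norm2 lam = 1 -> forall t : nat, (1 <= t)%N ->
    exists2 Y, is_cond_prob (filtration w z t)
                 [set om | sigma <= `|dot lam (z t.+1 om)|] Y
             & {ae P, forall om, p <= Y om}.

Record compact_iid_noise (nx : nat) (W : set 'cV[R]_nx)
    (w : nat -> Omega -> 'cV[R]_nx) (Sigma_w : 'M[R]_nx) : Prop := {
  noise_compact : compact W;
  noise_convex : convex_set (W : set (convex_lmodType 'cV[R]_nx));
  noise_interior : interior W !=set0;
  noise_support : forall t, {ae P, forall om, W (w t om)};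
  noise_indep : mutually_independent w;
  noise_ident : identically_distributed w;
  noise_mean : forall t i, ('E_P[(fun om => w t om i ord0)] = 0)%E;
  noise_cov : forall t i j,
    covariance P (fun om => w t om i 0) (fun om => w t om j 0)
      = (Sigma_w i j)%:E;
  noise_posdef : posdef Sigma_w
}.

Record bounded_BMSB (nx nz : nat) (w : nat -> Omega -> 'cV[R]_nx)
    (z : nat -> Omega -> 'cV[R]_nz) (b_z sigma_z p_z : R) : Prop := {
  excit_bounded : forall t, {ae P, forall om, norm2 (z t om) <= b_z};
  excit_sigma : 0 < sigma_z;
  excit_p : 0 < p_z <= 1;
  excit_BMSB : BMSB w z sigma_z p_z
}.

(* The pairs (c_i, h_i) are indexed by an arbitrary type: I := 'I_chi is the
   case of finitely many points, and infinite I is allowed. *)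
Record slice_visiting_noise (nx : nat) (W : set 'cV[R]_nx)
    (w : nat -> Omega -> 'cV[R]_nx) (I : Type) (c h : I -> 'cV[R]_nx)
    (p_w : R -> R) : Prop := {
  visit_supporting : forall i, supporting W (c i) (h i);
  visit_compact : compact (\bigcap_(i in [set: I]) halfspace (c i) (h i));
  visit_pw_gt0 : forall eps, 0 < eps -> 0 < p_w eps;
  visit_prob : forall eps, 0 < eps -> forall t i,
    ((p_w eps)%:E <= P (w t @^-1` slice W eps (c i) (h i)))%E
}.

End Probability.

Section System.
Context {R : realType} {Omega : Type} {nx nu : nat}.

Definition regressor (x : nat -> Omega -> 'cV[R]_nx)
    (u : nat -> Omega -> 'cV[R]_nu) (t : nat) (om : Omega) : 'cV[R]_(nx + nu) :=
  col_mx (x t om) (u t om).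

Definition membership_set (W : set 'cV[R]_nx) (x : nat -> Omega -> 'cV[R]_nx)
    (u : nat -> Omega -> 'cV[R]_nu) (T : nat) (om : Omega) :
    set 'M[R]_(nx, nx + nu) :=
  [set th | forall t, (t < T)%N ->
     W (x t.+1 om - th *m regressor x u t om)].

End System.

(* Main.v *)
(* Let G = th - theta_star for a feasible th, so that w_t - G z_t lies in W for
   all t < T, and cut the instants 1, ..., T - 1 into k = ceil(T/m) - 1 blocks
   of length m.

   Excitation.  A Chernoff bound and a union bound over a net of the unit
   sphere of R^nz show that, outside an event accounted for by the first term,
   every matrix Y of Frobenius norm 1 satisfies |Y z_t| >= (5/8) sigma_z p_z for
   some t in each block; then some h_i has h_i . (Y z_t) >= 2 a1 xi.

   Survival.  If diam > delta, some G has norm > delta/2 and its direction is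
   close to some Y of a net of the unit sphere of R^(nx nz).  At each instant at
   which Y is excited along h_i, w_t cannot lie in the slice at c_i, since
   otherwise w_t - G z_t would leave W.  As w_t is independent of the past, this
   happens k times with probability at most (1 - p_w)^k.

   Nets obtained by rounding to a cubic grid have at most (6 + 3/v)^n points for
   radius v, and the constants of the theorem leave enough room for this to be
   at most a2^nz and a5^(nx nz): the soft-O factors can be taken to be the
   constants 3 and 1. *)

Require Import Defs.
From HB Require Import structures.
From mathcomp Require Import all_boot all_order all_algebra.
From mathcomp Require Import all_classical all_reals all_analysis.
From mathcomp Require Import measurable_realfun ring lra.
Import Order.TTheory GRing.Theory Num.Theory.
Import numFieldNormedType.Exports.
Local Open Scope classical_set_scope.
Local Open Scope ring_scope.

(** * Counting integer points of bounded l^1 norm *)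

Section Net.
Context {R : realType}.

Lemma sum_sqr_ge0 (I : finType) (a : I -> R) : 0 <= \sum_i a i ^+ 2.
Proof. by apply: sumr_ge0 => i _; exact: sqr_ge0. Qed.

(** Expanding the sum of the squares [(A * b i - t * a i) ^+ 2] gives A (A B - t^2), which is
    nonnegative; the case A = 0 forces all [a i] to vanish. *)
Lemma cauchy_schwarz_sum (I : finType) (a b : I -> R) :
  (\sum_i a i * b i) ^+ 2 <= (\sum_i a i ^+ 2) * \sum_i b i ^+ 2.
Proof.
set A := \sum_i a i ^+ 2; set B := \sum_i b i ^+ 2; set t := \sum_i a i * b i.
have := sum_sqr_ge0 I (fun i => A * b i - t * a i).
have E i : (A * b i - t * a i) ^+ 2 = A ^+ 2 * b i ^+ 2
    + (- (2 * A * t)) * (a i * b i) + t ^+ 2 * a i ^+ 2 by ring.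
under eq_bigr do rewrite E.
rewrite !big_split/= -!mulr_sumr -/A -/B -/t => H.
have : 0 <= A by exact: sum_sqr_ge0.
rewrite le_eqVlt => /orP[/eqP A0|Apos].
  have a0 i : a i = 0.
    apply/eqP; rewrite -sqrf_eq0; apply/eqP.
    by have /psumr_eq0P := esym A0; apply => // j _; exact: sqr_ge0.
  rewrite /t; under eq_bigr do rewrite a0 mul0r.
  by rewrite big1_eq -A0 mul0r expr0n.
rewrite -subr_ge0 -(pmulr_rge0 _ Apos).
by apply: le_trans H _; rewrite le_eqVlt; apply/orP; left; apply/eqP; ring.
Qed.

(** From exp(-1/6) >= 5/6 one gets exp(-1) >= (5/6)^6, which exceeds 1/3. *)
Lemma expR1_le3 : expR 1 <= 3 :> R.
Proof.
have h : 5 / 6 <= expR (- (1 / 6)) :> R.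
  by apply: le_trans (expR_ge1Dx _); lra.
have : (5 / 6) ^+ 6 <= expR (- 1) :> R.
  rewrite (_ : - 1 = 6%:R * - (1 / 6) :> R); last by lra.
  by rewrite expRM_natl lerXn2r// ?nnegrE ?expR_ge0//; lra.
move=> h6; have e0 := expR_gt0 (1 : R).
have : expR 1 * expR (- 1) = 1 :> R by rewrite -expRD subrr expR0.
nra.
Qed.

(* The integers -M, ..., M, encoded by 'I_(M + M.+1). *)
Definition digit (M : nat) (k : 'I_(M + M.+1)) : R :=
  match fintype.split k with inl i => - i.+1%:R | inr i => i%:R end.

Lemma sum_expr_le (r : R) (M : nat) : 0 <= r < 1 ->
  \sum_(i < M) r ^+ i <= (1 - r)^-1.
Proof.
move=> /andP[r0 r1]; have d : 0 < 1 - r by lra.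
rewrite -(ler_pM2l d) divff ?gt_eqF//.
by rewrite -opprB mulNr -subrX1 opprB lerBlDr lerDl exprn_ge0.
Qed.

(** With r = exp(-1/al), the negative and nonnegative digits form two geometric sums of total at
    most (1 + r)/(1 - r) = 2/(1 - r) - 1, and exp(1/al) >= 1 + 1/al yields 1/(1 - r) <= 1 + al. *)
Lemma sum_expR_digit (M : nat) (al : R) : 0 < al ->
  \sum_(k : 'I_(M + M.+1)) expR (- `|digit M k| / al) <= 1 + 2 * al.
Proof.
move=> al0; set r := expR (- al^-1).
have rE (i : nat) : expR (- i%:R / al) = r ^+ i.
  by rewrite -expRM_natl; congr expR; rewrite mulrN mulNr.
have r0 : 0 < r by exact: expR_gt0.
have r1 : r * (1 + al) <= al.
  have : 1 + al^-1 <= expR (al^-1) by exact: expR_ge1Dx.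
  have : r * expR (al^-1) = 1 by rewrite -expRD addNr expR0.
  have ai : 0 < al^-1 by rewrite invr_gt0.
  have aa : al * al^-1 = 1 by rewrite divff ?gt_eqF.
  move=> e1 e2.
  have e3 : r * (1 + al^-1) <= 1.
    by apply: le_trans (_ : r * expR al^-1 <= _); rewrite ?ler_pM2l// e1.
  by have := ler_wpM2l (ltW al0) e3; rewrite mulr1; nra.
have rlt1 : r < 1 by rewrite -(ltr_pM2r (_ : 0 < 1 + al)); lra.
rewrite big_split_ord/=.
under eq_bigr => i _ do
  rewrite /digit (unsplitK (inl i)) normrN normr_nat rE exprS.
under [X in _ + X]eq_bigr => i _ do
  rewrite /digit (unsplitK (inr i)) normr_nat rE.
rewrite -mulr_sumr.
have rr : 0 <= r < 1 by rewrite ltW.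
have h1 := sum_expr_le r M rr; have h2 := sum_expr_le r M.+1 rr.
have d : 0 < 1 - r by lra.
have h3 : (1 - r)^-1 <= 1 + al.
  by rewrite -(ler_pM2l d) divff ?gt_eqF//; nra.
have : 0 <= (1 - r)^-1 by rewrite invr_ge0 ltW.
have e : (1 - r) * (1 - r)^-1 = 1 by rewrite divff ?gt_eqF.
nra.
Qed.

(* The weight exp(#|I| - |k|_1 / al) is at least 1 on the ball, and its sum over
   all k factorizes over the coordinates. *)
Lemma card_l1_ball_le (I : finType) (M : nat) (al : R) : 0 < al ->
  #|[set f : {ffun I -> 'I_(M + M.+1)} |
      \sum_i `|digit M (f i)| <= #|I|%:R * al]%SET|%:R
  <= (3 * (1 + 2 * al)) ^+ #|I| :> R.
Proof.
move=> al0; set S := [set f | _]%SET.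
rewrite -sum1_card natr_sum.
pose wt (f : {ffun I -> 'I_(M + M.+1)}) : R :=
  expR #|I|%:R * \prod_i expR (- `|digit M (f i)| / al).
have wt0 f : 0 <= wt f.
  by rewrite mulr_ge0 ?expR_ge0// prodr_ge0// => i _; exact: expR_ge0.
apply: (@le_trans _ _ (\sum_(f in S) wt f)).
  apply: ler_sum => f; rewrite inE => fS.
  rewrite /wt -expR_sum -expRD -[X in X <= _](@expR0 R) ler_expR.
  rewrite -mulr_suml sumrN mulNr subr_ge0 ler_pdivrMr//.
apply: (@le_trans _ _ (\sum_f wt f)).
  rewrite [leRHS](bigID (mem S))/= lerDl sumr_ge0//.
rewrite -mulr_sumr exprMn.
rewrite -(bigA_distr_bigA (fun (_ : I) k => expR (- `|digit M k| / al))).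
rewrite prodr_const; apply: ler_pM.
- exact: expR_ge0.
- by rewrite exprn_ge0// sumr_ge0// => ? _; exact: expR_ge0.
- rewrite -[X in expR X]mulr1 expRM_natl lerXn2r// ?nnegrE ?expR_ge0//.
  exact: expR1_le3.
- rewrite lerXn2r// ?nnegrE//.
  + by rewrite sumr_ge0// => ? _; exact: expR_ge0.
  + by lra.
  + exact: sum_expR_digit.
Qed.

Lemma nearest_digit (M : nat) (x : R) : `|x| <= M%:R ->
  exists k : 'I_(M + M.+1), `|x - digit M k| <= 1 / 2.
Proof.
rewrite ler_norml => /andP[xM Mx].
have /andP[fl fu] := Num.Theory.floor_itv (x + 1 / 2).
(* The two constructors of the integer floor match the two halves of [digit]: [Negz i] and the left
   index i both stand for -(i + 1). *)
case: (Num.floor (x + 1 / 2)) fl fu => i.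
  move=> fl fu.
  have iM : (i < M.+1)%N.
    by rewrite -(ltr_nat R) -natr1; move: fl; rewrite -pmulrn; lra.
  exists (rshift M (Ordinal iM)).
  rewrite /digit (unsplitK (inr (Ordinal iM)))/= ler_norml.
  by move: fl fu; rewrite intrD /= -!pmulrn => fl fu; apply/andP; split; lra.
move=> fl fu; have iM : (i < M)%N.
  rewrite -(ltr_nat R).
  move: fu; rewrite NegzE intrD mulrNz -!pmulrn -(natr1 i).
  by move: xM Mx; set a : R := M%:R; set b : R := i%:R; lra.
exists (lshift M.+1 (Ordinal iM)).
rewrite /digit (unsplitK (inl (Ordinal iM)))/= ler_norml.
move: fl fu; rewrite NegzE intrD mulrNz -!pmulrn => fl fu.
by apply/andP; split; lra.
Qed.

End Net.

(** * Finite nets of the Euclidean unit sphere *)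

Section SphereNet.
Context {R : realType}.

Lemma sum_normr_le (I : finType) (x : I -> R) : \sum_i x i ^+ 2 = 1 ->
  \sum_i `|x i| <= Num.sqrt #|I|%:R.
Proof.
move=> x1; have S0 : 0 <= \sum_i `|x i| by exact: sumr_ge0.
rewrite -[leLHS](ger0_norm S0) -sqrtr_sqr ler_sqrt ?ler0n//.
have := cauchy_schwarz_sum I (fun i => `|x i|) (fun=> 1).
under eq_bigr do rewrite mulr1.
under [in leRHS]eq_bigr do rewrite real_normK ?num_real//.
rewrite x1 mul1r; under [leRHS]eq_bigr do rewrite expr1n.
by rewrite sumr_const.
Qed.

(* Rounding to the nearest point of the grid of mesh s = 2 v / sqrt n moves x by
   at most v and yields integer coordinates of l^1 norm at most n al. *)
Lemma grid_net (I : finType) (v : R) : 0 < v ->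
  exists S : seq {ffun I -> R},
    (size S)%:R <= (6 + 3 / v) ^+ #|I| /\
    (forall x : I -> R, \sum_i x i ^+ 2 = 1 ->
      exists2 y : {ffun I -> R}, y \in S & \sum_i (x i - y i) ^+ 2 <= v ^+ 2).
Proof.
move=> v0; set n := #|I|.
have [n0|n0] := posnP n.
  exists [::]; split; first by rewrite exprn_ge0// addr_ge0// divr_ge0// ltW.
  move=> x; rewrite big1; first by move=> /esym/eqP; rewrite oner_eq0.
  by move=> i; have := card0_eq n0 i.
have nR : 0 < n%:R :> R by rewrite ltr0n.
pose s : R := 2 * v / Num.sqrt n%:R.
have sn0 : 0 < Num.sqrt n%:R :> R by rewrite sqrtr_gt0.
have s0 : 0 < s by rewrite divr_gt0// mulr_gt0.
(* Coordinates of a unit vector divided by the mesh are at most 1/s in absolute value, so digits up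
   to M >= 1/s suffice. *)
pose M := (Num.truncn (s^-1)).+1.
have sM : s^-1 <= M%:R.
  by apply: ltW; exact: truncnS_gt.
(* The rounded point has l^1 norm at most n/(2v) from x/s plus n/2 from rounding, that is n [al];
   moreover 3 (1 + 2 [al]) = 6 + 3/v. *)
pose al : R := (v^-1 + 1) / 2.
have vi0 : 0 < v^-1 by rewrite invr_gt0.
have al0 : 0 < al by rewrite /al; lra.
pose D := [set f : {ffun I -> 'I_(M + M.+1)} |
      \sum_i `|digit (R := R) M (f i)| <= #|I|%:R * al]%SET.
exists [seq [ffun i => s * digit M (f i)] | f : {ffun I -> 'I_(M + M.+1)} <- enum D]; split.
  rewrite size_map -cardE (le_trans (card_l1_ball_le I M al al0))//.
  have E : 3 * (1 + 2 * al) = 6 + 3 / v by rewrite /al; lra.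
  by rewrite E.
move=> x x1.
have xs i : `|x i / s| <= M%:R.
  rewrite normrM (gtr0_norm (_ : 0 < s^-1)) ?invr_gt0//.
  apply: le_trans sM; rewrite ler_piMl// ?invr_ge0; first exact: ltW.
  rewrite -(expr_le1 (n := 2))// real_normK ?num_real// -x1.
  by rewrite (bigD1 i)//= lerDl sumr_ge0// => j _; exact: sqr_ge0.
have /choice[k kP] : forall i, exists k : 'I_(M + M.+1), `|x i / s - digit M k| <= 1 / 2.
  by move=> i; exact: nearest_digit.
exists [ffun i => s * digit M (k i)].
  apply/mapP; exists [ffun i => k i]; last first.
    by apply/ffunP => i; rewrite !ffunE.
  rewrite mem_enum inE.
  apply: (@le_trans _ _ (\sum_i (`|x i| / s + 1 / 2))).
    apply: ler_sum => i _; rewrite ffunE -(gtr0_norm s0) -normfV -normrM.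
    rewrite -lerBlDl; apply: le_trans (kP i); rewrite distrC.
    exact: lerB_dist.
  rewrite big_split/= -mulr_suml sumr_const -/n.
  have : (\sum_i `|x i|) / s <= n%:R / (2 * v).
    rewrite ler_pdivrMr// (_ : _ * s = Num.sqrt n%:R); last first.
      rewrite /s -{1}(sqr_sqrtr (ltW nR)); field.
      by rewrite !gt_eqF.
    exact: sum_normr_le.
  rewrite (_ : n%:R / (2 * v) = n%:R * (v^-1 / 2)); last first.
    by rewrite invfM; ring.
  by rewrite -[1 / 2 *+ n]mulr_natl /al; move: (n%:R : R) => N; lra.
apply: (@le_trans _ _ (\sum_(i : I) (s / 2) ^+ 2)).
  apply: ler_sum => i _; rewrite ffunE -[leLHS]real_normK ?num_real//.
  rewrite lerXn2r ?nnegrE//; first by rewrite divr_ge0// ltW.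
  rewrite (_ : x i - _ = s * (x i / s - digit M (k i))); last first.
    by rewrite mulrBr mulrCA divff ?gt_eqF// mulr1.
  rewrite normrM (gtr0_norm s0) ler_pM2l//.
  by have := kP i; rewrite mul1r.
have E : (s / 2) ^+ 2 = v ^+ 2 / n%:R.
  rewrite -[in RHS](sqr_sqrtr (ltW nR)) /s; field.
  by rewrite gt_eqF.
by rewrite E sumr_const -/n -[_ *+ n]mulr_natl mulrCA divff ?gt_eqF// mulr1.
Qed.

(* 1 - (x . u)^2 is the squared distance from x to the line spanned by u, which
   does not change when a net point is normalized. *)
Lemma sphere_net (I : finType) (v : R) : 0 < v < 1 ->
  exists S : seq {ffun I -> R},
    [/\ (size S)%:R <= (6 + 3 / v) ^+ #|I|,
        (forall u, u \in S -> \sum_i u i ^+ 2 = 1)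
      & (forall x : I -> R, \sum_i x i ^+ 2 = 1 ->
        exists u : {ffun I -> R},
          [/\ u \in S, 0 < \sum_i x i * u i &
              1 - v ^+ 2 <= (\sum_i x i * u i) ^+ 2])].
Proof.
move=> /andP[v0 v1]; have [S [sS S_net]] := grid_net I v v0.
pose nz (y : {ffun I -> R}) := \sum_i y i ^+ 2 != 0.
pose nm (y : {ffun I -> R}) : {ffun I -> R} :=
  [ffun i => y i / Num.sqrt (\sum_j y j ^+ 2)].
exists [seq nm y | y <- S & nz y]; split.
- apply: le_trans sS; rewrite size_map ler_nat size_filter; exact: count_size.
- move=> u /mapP[y]; rewrite mem_filter => /andP[yn _] ->.
  under eq_bigr do rewrite ffunE expr_div_n sqr_sqrtr ?sum_sqr_ge0//.
  by rewrite -mulr_suml divff.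
move=> x x1; have [y yS xy] := S_net x x1.
set Y := \sum_i y i ^+ 2; set t := \sum_i x i * y i.
have dE : \sum_i (x i - y i) ^+ 2 = 1 - 2 * t + Y.
  under eq_bigr do rewrite sqrrB.
  rewrite !big_split/= x1 sumrN -/Y; congr (_ - _ + _).
  by rewrite /t mulr_sumr; apply: eq_bigr => i _; rewrite mulr_natl.
have v21 : v ^+ 2 < 1 by rewrite expr_lt1// ltW.
have Y0 : 0 <= Y by exact: sum_sqr_ge0.
have t0 : 0 < t by move: xy; rewrite dE; lra.
have Yn : 0 < Y.
  rewrite lt_neqAle Y0 andbT; apply/eqP => YE.
  have := cauchy_schwarz_sum I x y; rewrite x1 -/Y -/t -YE mulr0.
  by move=> h; have := exprn_gt0 2 t0; lra.
have r0 : 0 < Num.sqrt Y by rewrite sqrtr_gt0.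
have tE : \sum_i x i * nm y i = t / Num.sqrt Y.
  by under eq_bigr do rewrite ffunE mulrA; rewrite -mulr_suml.
exists (nm y); split; rewrite ?tE ?divr_gt0//.
  by apply/mapP; exists y => //; rewrite mem_filter yS andbT /nz gt_eqF.
rewrite expr_div_n sqr_sqrtr// ler_pdivlMr//.
move: xy; rewrite dE => xy.
(* The net estimate gives 1 - v^2 <= 2t - Y, so (1 - v^2) Y <= 2tY - Y^2 <= t^2. *)
have := sqr_ge0 (t - Y); nra.
Qed.

End SphereNet.

(** * Real-valued probabilities and counting of events along time *)

Section Counting.
Context {R : realType} {d : measure_display} {Omega : measurableType d}.
Variable P : probability Omega R.

Definition pr (A : set Omega) : R := fine (P A).

Lemma prE A : measurable A -> P A = (pr A)%:E.
Proof. by move=> mA; rewrite /pr fineK// fin_num_measure. Qed.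

Lemma pr_ge0 A : 0 <= pr A.
Proof. exact/fine_ge0. Qed.

Lemma pr_le A B : measurable A -> measurable B -> A `<=` B -> pr A <= pr B.
Proof.
move=> mA mB AB; rewrite -lee_fin -!prE//.
by apply: le_measure; rewrite ?inE.
Qed.

Lemma pr_le1 A : measurable A -> pr A <= 1.
Proof. by move=> mA; rewrite -lee_fin -prE//; exact: probability_le1. Qed.

Lemma pr_setT : pr setT = 1.
Proof. by rewrite /pr probability_setT. Qed.

Lemma pr_split A B : measurable A -> measurable B ->
  pr A = pr (A `&` B) + pr (A `&` ~` B).
Proof.
move=> mA mB; have mC := measurableC mB.
apply: EFin_inj; rewrite EFinD -!prE//; [|exact: measurableI..].
rewrite -measureU//; [|exact: measurableI..|].
  by rewrite -setIUr setUv setIT.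
by rewrite setIACA setICr setI0.
Qed.

Lemma pr_setU A B : measurable A -> measurable B ->
  pr (A `|` B) <= pr A + pr B.
Proof.
move=> mA mB; rewrite -lee_fin EFinD -!prE//; last exact: measurableU.
exact: measureU2.
Qed.

Definition hits (B : nat -> set Omega) (s L : nat) (om : Omega) : nat :=
  \sum_(s <= t < s + L) (om \in B t).

Lemma hits0 B s om : hits B s 0 om = 0%N.
Proof. by rewrite /hits addn0 big_geq. Qed.

Lemma hitsS B s L om :
  hits B s L.+1 om = ((om \in B s) + hits B s.+1 L om)%N.
Proof. by rewrite /hits big_ltn ?addSnnS// addnS ltnS leq_addr. Qed.

Lemma hits_lt_split B s L r :
  [set om | (hits B s L.+1 om < r)%N] =
  (B s `&` [set om | (hits B s.+1 L om < r.-1)%N]) `|`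
  (~` B s `&` [set om | (hits B s.+1 L om < r)%N]).
Proof.
apply/seteqP; split => om /=; rewrite hitsS.
  by case: (pselect (B s om)) => h;
    [rewrite mem_set//= add1n -ltn_predRL; left|rewrite memNset//= add0n; right].
by case=> -[h]; [rewrite mem_set//= add1n ltn_predRL|rewrite memNset//= add0n].
Qed.

Lemma measurable_hits_lt B s L r : (forall t, measurable (B t)) ->
  measurable [set om | (hits B s L om < r)%N].
Proof.
move=> mB; elim: L s r => [|L IH] s r.
  rewrite (_ : [set _ | _] = if (0 < r)%N then setT else set0); first by case: ifP.
  by apply/seteqP; split => om /=; rewrite hits0; case: ifP.
rewrite hits_lt_split; apply: measurableU; apply: measurableI => //.
exact: measurableC.
Qed.

(** In the application, [Q t] says that a fixed direction is excited at time t, and [D t] that the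
    noise then misses the relevant slices. *)
Definition surviving (Q D : nat -> set Omega) (s L r : nat) : set Omega :=
  [set om | (r <= hits Q s L om)%N /\
     forall t, (s <= t < s + L)%N -> Q t om -> D t om].

(** Case split on the first instant. For r = 0 the truncated [r.-1] is harmless, since the condition
    on the count is then void. *)
Lemma surviving_split Q D s L r : surviving Q D s L.+1 r =
  (Q s `&` D s `&` surviving Q D s.+1 L r.-1) `|`
  (~` Q s `&` surviving Q D s.+1 L r).
Proof.
apply/seteqP; split => om /=; rewrite /surviving/= hitsS.
  move=> [rh QD]; have QD' t : (s.+1 <= t < s.+1 + L)%N -> Q t om -> D t om.
    by move=> /andP[st tL]; apply: QD; rewrite (ltnW st) -addSnnS.
  have [h|h] := pselect (Q s om); [left|right].
    move: rh; rewrite mem_set//= add1n => rh; split; last first.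
      by split => //; case: r rh.
    by split => //; apply: QD => //; rewrite leqnn addnS ltnS leq_addr.
  by move: rh; rewrite memNset.
have step t : (s <= t < s + L.+1)%N -> t = s \/ (s.+1 <= t < s.+1 + L)%N.
  by rewrite addSnnS => /andP[]; rewrite leq_eqVlt => /orP[/eqP->|-> ->];
    [left|right].
case=> -[].
  move=> [Qs Ds] [rh QD]; rewrite mem_set//= add1n; split.
    by case: r rh.
  by move=> t /step[->//|]; exact: QD.
move=> Qs [rh QD]; rewrite memNset//= add0n; split=> //.
by move=> t /step[->//|]; exact: QD.
Qed.

Lemma measurable_surviving Q D s L r : (forall t, measurable (Q t)) ->
  (forall t, measurable (D t)) -> measurable (surviving Q D s L r).
Proof.
move=> mQ mD; elim: L s r => [|L IH] s r.
  rewrite (_ : surviving _ _ _ _ _ = if r == 0%N then setT else set0).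
    by case: ifP.
  apply/seteqP; split => om; rewrite /surviving/= hits0 leqn0.
    by move=> [/eqP-> _]; rewrite eqxx.
  case: ifP => // r0 _; split => // t /andP[st]; rewrite addn0 => ts.
  by have := leq_ltn_trans st ts; rewrite ltnn.
rewrite surviving_split; apply: measurableU; apply: measurableI => //.
  exact: measurableI.
exact: measurableC.
Qed.

(** * Recursive probability bounds along an abstract filtration *)

Section Filtration.
Variable F : nat -> set (set Omega).
Hypothesis F_measurable : forall t A, F t A -> measurable A.
Hypothesis F_setI : forall t A B, F t A -> F t B -> F t (A `&` B).
Hypothesis F_setC : forall t A, F t A -> F t (~` A).
Hypothesis F_mono : forall t A, F t A -> F t.+1 A.

(* A Chernoff bound: the exponential moment of the number of hits is taken at
   1/2, and the induction peels off the first step, so that only conditional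
   probabilities of a single step given the past are needed. *)
Lemma few_hits_le (B : nat -> set Omega) (p : R) (t0 : nat) :
  p <= 1 -> (forall t, F t (B t)) ->
  (forall t A, (t0 <= t)%N -> F t A -> p * pr A <= pr (A `&` B t.+1)) ->
  forall L t r A, (t0 <= t)%N -> F t A ->
  pr (A `&` [set om | (hits B t.+1 L om < r)%N]) <=
    2 ^+ r * (1 - p / 2) ^+ L * pr A.
Proof.
move=> p1 FB cond; have mB t : measurable (B t) by exact: F_measurable (FB t).
have mh s L r := measurable_hits_lt B s L r mB.
have q0 : 0 <= 1 - p / 2 by lra.
elim=> [|L IH] t [|r] A tt FA; have mA := F_measurable _ _ FA.
- rewrite (_ : _ `&` _ = set0).
    rewrite /pr measure0/= mulr_ge0//; last exact: pr_ge0.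
    by rewrite mulr_ge0// exprn_ge0.
  by apply/seteqP; split => om //= [].
- apply: (@le_trans _ _ (pr A)); first by apply: pr_le => //; exact: measurableI.
  rewrite mulr1 ler_peMl ?pr_ge0//.
  by rewrite exprn_ege1// ler1n.
- rewrite (_ : _ `&` _ = set0).
    rewrite /pr measure0/= mulr_ge0//; last exact: pr_ge0.
    by rewrite mulr_ge0// exprn_ge0.
  by apply/seteqP; split => om //= [].
- have FA1 := F_mono _ _ FA; have FB1 := FB t.+1.
  have mAh : measurable (A `&` [set om | (hits B t.+1 L.+1 om < r.+1)%N]).
    exact: measurableI.
  rewrite (pr_split _ (B t.+1))//.
  have -> : A `&` [set om | (hits B t.+1 L.+1 om < r.+1)%N] `&` B t.+1 =
      A `&` B t.+1 `&` [set om | (hits B t.+2 L om < r)%N].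
    rewrite hits_lt_split; apply/seteqP; split => om /=; last by tauto.
    by move=> [[? [[]|[]]]].
  have -> : A `&` [set om | (hits B t.+1 L.+1 om < r.+1)%N] `&` ~` B t.+1 =
      A `&` ~` B t.+1 `&` [set om | (hits B t.+2 L om < r.+1)%N].
    rewrite hits_lt_split; apply/seteqP; split => om /=; last by tauto.
    by move=> [[? [[]|[]]]].
  have h1 := IH t.+1 r (A `&` B t.+1) (leqW tt) (F_setI _ _ _ FA1 FB1).
  have h2 := IH t.+1 r.+1 (A `&` ~` B t.+1) (leqW tt)
    (F_setI _ _ _ FA1 (F_setC _ _ FB1)).
  apply: le_trans (lerD h1 h2) _.
  have := cond t A tt FA; have := pr_split A (B t.+1) mA (mB _).
  set a := pr (A `&` B _); set b := pr (A `&` ~` _) => -> ha.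
  rewrite !exprS; set c : R := 2 ^+ r; set e : R := _ ^+ L.
  have ce : 0 <= c * e by rewrite mulr_ge0// exprn_ge0.
  (* The target exceeds the sum of the two inductive bounds by a multiple of a - p (a + b), which
     the conditional lower bound makes nonnegative. *)
  have E : 2 * c * ((1 - p / 2) * e) * (a + b) =
      c * e * a + 2 * c * e * b + c * e * (a - p * (a + b)) by field.
  by rewrite E lerDl mulr_ge0// subr_ge0.
Qed.

(** Induction on the window, peeling off its first instant. Outside [Q s] nothing is paid and r is
    unchanged; inside, [D s] costs a factor q given the past and r drops by one. *)
Lemma surviving_le (Q D : nat -> set Omega) (q : R) :
  0 <= q <= 1 -> (forall t, F t (Q t)) -> (forall t, F t.+1 (D t)) ->
  (forall t A, F t A -> A `<=` Q t -> pr (A `&` D t) <= q * pr A) ->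
  forall L s r A, F s A ->
  pr (A `&` surviving Q D s L r) <= q ^+ r * pr A.
Proof.
move=> /andP[q0 q1] FQ FD cond.
have mQ t : measurable (Q t) by exact: F_measurable (FQ t).
have mD t : measurable (D t) by exact: F_measurable (FD t).
have mS s L r := measurable_surviving Q D s L r mQ mD.
elim=> [|L IH] s r A FA; have mA := F_measurable _ _ FA.
  case: r => [|r].
    by rewrite mul1r; apply: pr_le => //; exact: measurableI.
  rewrite (_ : _ `&` _ = set0).
    by rewrite /pr measure0/= mulr_ge0// ?exprn_ge0//; exact: pr_ge0.
  by apply/seteqP; split => om //=; rewrite /surviving/= hits0 => -[_ []].
have FA1 := F_mono _ _ FA; have FQ1 := F_mono _ _ (FQ s).
have mAh : measurable (A `&` surviving Q D s L.+1 r) by exact: measurableI.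
rewrite (pr_split _ (Q s))//.
have -> : A `&` surviving Q D s L.+1 r `&` Q s =
    A `&` Q s `&` D s `&` surviving Q D s.+1 L r.-1.
  rewrite surviving_split; apply/seteqP; split => om /=; last by tauto.
  by move=> [[? [[[]]|[]]]].
have -> : A `&` surviving Q D s L.+1 r `&` ~` Q s =
    A `&` ~` Q s `&` surviving Q D s.+1 L r.
  rewrite surviving_split; apply/seteqP; split => om /=; last by tauto.
  by move=> [[? [[[]]|[]]]].
have h1 := IH s.+1 r.-1 _ (F_setI _ _ _ (F_setI _ _ _ FA1 FQ1) (FD s)).
have h2 := IH s.+1 r _ (F_setI _ _ _ FA1 (F_setC _ _ FQ1)).
have h3 := cond s (A `&` Q s) (F_setI _ _ _ FA (FQ s)) (@subIsetr _ _ _).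
apply: le_trans (lerD h1 h2) _; rewrite (pr_split A (Q s))// mulrDr lerD2r.
apply: (@le_trans _ _ (q ^+ r.-1 * (q * pr (A `&` Q s)))).
  by rewrite ler_wpM2l// exprn_ge0.
rewrite mulrA -exprSr ler_wpM2r ?pr_ge0//.
(* For r > 0 the powers agree; for r = 0 the truncated predecessor leaves one factor q too many,
   absorbed by q <= 1. *)
by case: r {h1 h2 mAh} => //=; rewrite expr1 expr0.
Qed.

End Filtration.
End Counting.

(** * Euclidean and Frobenius norms, continuity and compactness *)

Section Vectors.
Context {R : realType}.

Lemma ler_of_sqr (x y : R) : 0 <= y -> x ^+ 2 <= y ^+ 2 -> x <= y.
Proof. by move=> y0; rewrite !expr2 => xy; rewrite leNgt; apply/negP => h; nra. Qed.

Lemma dotE n (u v : 'cV[R]_n) : dot u v = \sum_i u i 0 * v i 0.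
Proof. by rewrite /dot mxE; apply: eq_bigr => i _; rewrite mxE. Qed.

Lemma dotC n (u v : 'cV[R]_n) : dot u v = dot v u.
Proof. by rewrite !dotE; apply: eq_bigr => i _; rewrite mulrC. Qed.

Lemma dotDr n (u v w : 'cV[R]_n) : dot u (v + w) = dot u v + dot u w.
Proof. by rewrite /dot mulmxDr mxE. Qed.

Lemma dotNr n (u v : 'cV[R]_n) : dot u (- v) = - dot u v.
Proof. by rewrite /dot mulmxN mxE. Qed.

Lemma dotBr n (u v w : 'cV[R]_n) : dot u (v - w) = dot u v - dot u w.
Proof. by rewrite dotDr dotNr. Qed.

Lemma dotZr n (u v : 'cV[R]_n) a : dot u (a *: v) = a * dot u v.
Proof. by rewrite /dot -scalemxAr mxE. Qed.

Lemma norm2_ge0 p q (A : 'M[R]_(p, q)) : 0 <= norm2 A.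
Proof. exact: sqrtr_ge0. Qed.

Lemma norm2_sqr p q (A : 'M[R]_(p, q)) :
  norm2 A ^+ 2 = \sum_(k : 'I_p * 'I_q) A k.1 k.2 ^+ 2.
Proof.
rewrite sqr_sqrtr; last by do 2!apply: sumr_ge0 => ? _; exact: sqr_ge0.
by rewrite pair_big.
Qed.

Lemma norm2_sqr_cV n (v : 'cV[R]_n) : norm2 v ^+ 2 = \sum_i v i 0 ^+ 2.
Proof.
rewrite sqr_sqrtr; last by do 2!apply: sumr_ge0 => ? _; exact: sqr_ge0.
by apply: eq_bigr => i _; rewrite big_ord1.
Qed.

Lemma norm2_sqr_rows p q (A : 'M[R]_(p, q)) :
  norm2 A ^+ 2 = \sum_i norm2 (row i A)^T ^+ 2.
Proof.
rewrite sqr_sqrtr; last by do 2!apply: sumr_ge0 => ? _; exact: sqr_ge0.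
apply: eq_bigr => i _; rewrite norm2_sqr_cV.
by apply: eq_bigr => j _; rewrite !mxE.
Qed.

Lemma dot_self n (v : 'cV[R]_n) : dot v v = norm2 v ^+ 2.
Proof. by rewrite dotE norm2_sqr_cV; apply: eq_bigr => i _; rewrite expr2. Qed.

Lemma norm2_eq0 p q (A : 'M[R]_(p, q)) : norm2 A = 0 -> A = 0.
Proof.
move=> /(congr1 (fun x => x ^+ 2)); rewrite norm2_sqr expr0n/= => /psumr_eq0P h.
apply/matrixP => i j; rewrite mxE; apply/eqP; rewrite -sqrf_eq0; apply/eqP.
by apply: (h _ (i, j)) => // k _; exact: sqr_ge0.
Qed.

Lemma norm2Z p q (A : 'M[R]_(p, q)) a : norm2 (a *: A) = `|a| * norm2 A.
Proof.
apply/eqP; rewrite -(@eqrXn2 _ 2)// ?norm2_ge0 ?mulr_ge0 ?norm2_ge0//.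
rewrite exprMn !norm2_sqr real_normK ?num_real// mulr_sumr; apply/eqP.
by apply: eq_bigr => k _; rewrite mxE exprMn.
Qed.

Lemma norm2N p q (A : 'M[R]_(p, q)) : norm2 (- A) = norm2 A.
Proof. by rewrite -scaleN1r norm2Z normrN1 mul1r. Qed.

Lemma dot_le n (u v : 'cV[R]_n) : `|dot u v| <= norm2 u * norm2 v.
Proof.
apply: ler_of_sqr; first by rewrite ?mulr_ge0 ?norm2_ge0.
rewrite real_normK ?num_real// exprMn !norm2_sqr_cV dotE.
exact: cauchy_schwarz_sum.
Qed.

Lemma norm2D p q (A B : 'M[R]_(p, q)) : norm2 (A + B) <= norm2 A + norm2 B.
Proof.
apply: ler_of_sqr; first by rewrite ?addr_ge0 ?norm2_ge0.
have E : norm2 (A + B) ^+ 2 = norm2 A ^+ 2 +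
    2 * (\sum_(k : 'I_p * 'I_q) A k.1 k.2 * B k.1 k.2) + norm2 B ^+ 2.
  rewrite !norm2_sqr mulr_sumr -!big_split/=; apply: eq_bigr => k _.
  by rewrite mxE; ring.
have CS : (\sum_(k : 'I_p * 'I_q) A k.1 k.2 * B k.1 k.2) ^+ 2 <=
    (norm2 A * norm2 B) ^+ 2.
  by rewrite exprMn !norm2_sqr; exact: cauchy_schwarz_sum.
have : \sum_(k : 'I_p * 'I_q) A k.1 k.2 * B k.1 k.2 <= norm2 A * norm2 B.
  apply: le_trans (ler_norm _) _.
  apply: ler_of_sqr; first by rewrite ?mulr_ge0 ?norm2_ge0.
  by rewrite real_normK ?num_real.
rewrite E; nra.
Qed.

(** The left side is the Frobenius inner product of A with the rank-one matrix h z^T, whose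
    Frobenius norm is |h| |z|; Cauchy-Schwarz applies. *)
Lemma dot_mulmx_le p q (h : 'cV[R]_p) (A : 'M[R]_(p, q)) (z : 'cV[R]_q) :
  `|dot h (A *m z)| <= norm2 h * norm2 A * norm2 z.
Proof.
apply: ler_of_sqr; first by rewrite ?mulr_ge0 ?norm2_ge0.
rewrite real_normK ?num_real//.
have -> : dot h (A *m z) =
    \sum_(k : 'I_p * 'I_q) A k.1 k.2 * (h k.1 0 * z k.2 0).
  rewrite dotE -(pair_big xpredT xpredT (fun i j => A i j * (h i 0 * z j 0)))/=.
  apply: eq_bigr => i _; rewrite mxE mulr_sumr.
  by apply: eq_bigr => j _; ring.
apply: le_trans (cauchy_schwarz_sum _ _ _) _.
have -> : (norm2 h * norm2 A * norm2 z) ^+ 2 =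
    norm2 A ^+ 2 * (norm2 h ^+ 2 * norm2 z ^+ 2) by ring.
rewrite !norm2_sqr_cV [norm2 A ^+ 2]norm2_sqr.
apply: ler_wpM2l; first by apply: sumr_ge0 => k _; exact: sqr_ge0.
rewrite -(pair_big xpredT xpredT (fun i j => (h i 0 * z j 0) ^+ 2))/=.
rewrite mulr_suml ler_sum// => i _; rewrite mulr_sumr ler_sum// => j _.
by rewrite exprMn.
Qed.

Lemma mx_entry_le p q (A : 'M[R]_(p, q)) i j : `|A i j| <= `|A|.
Proof.
rewrite [leRHS]/Num.Def.normr/= mx_normrE.
exact: (le_bigmax_cond (P := xpredT) 0 (fun ij => `|A ij.1 ij.2|) (j := (i, j))).
Qed.

Lemma mx_norm_le p q (A : 'M[R]_(p, q)) c : 0 <= c ->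
  (forall i j, `|A i j| <= c) -> `|A| <= c.
Proof.
move=> c0 h; rewrite [leLHS]/Num.Def.normr/= mx_normrE.
by apply/bigmax_leP; split => // -[i j] _ /=.
Qed.

Lemma mx_norm_le_norm2 p q (A : 'M[R]_(p, q)) : `|A| <= norm2 A.
Proof.
apply: mx_norm_le; first exact: norm2_ge0.
move=> i j; apply: ler_of_sqr; first exact: norm2_ge0.
rewrite real_normK ?num_real// norm2_sqr (bigD1 (i, j))//= lerDl.
by apply: sumr_ge0 => k _; exact: sqr_ge0.
Qed.

Lemma mulmx_norm_le p q (A : 'M[R]_(p, q)) (z : 'cV[R]_q) :
  `|A *m z| <= q%:R * `|A| * `|z|.
Proof.
apply: mx_norm_le => [|i j]; first by rewrite !mulr_ge0.
rewrite mxE; apply: le_trans (ler_norm_sum _ _ _) _.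
apply: (@le_trans _ _ (\sum_(k < q) `|A| * `|z|)).
  by apply: ler_sum => k _; rewrite normrM ler_pM// mx_entry_le.
by rewrite sumr_const card_ord -[X in X <= _]mulr_natl mulrA.
Qed.

Lemma continuous_sum_real (T : topologicalType) (I : Type) (r : seq I)
    (f : I -> T -> R) : (forall i, continuous (f i)) ->
  continuous (fun x => \sum_(i <- r) f i x).
Proof.
move=> cf; apply: (@continuous_big R I +%R 0 xpredT) => //.
exact: add_continuous.
Qed.

Lemma continuous_norm2 p q : continuous (@norm2 R p q).
Proof.
move=> A; apply: continuous_comp; last exact: sqrt_continuous.
apply: continuous_sum_real => i; apply: continuous_sum_real => j B.
apply: (@continuous_comp _ _ _ (fun M : 'M[R]_(p, q) => M i j) (fun x => x ^+ 2)).
  exact: coord_continuous.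
exact: exprn_continuous.
Qed.

Lemma continuous_dot n (u : 'cV[R]_n) : continuous (dot u).
Proof.
rewrite (_ : dot u = fun v => \sum_i u i 0 * v i 0); last first.
  by apply/funext => v; rewrite dotE.
apply: continuous_sum_real => i v.
by apply: continuousM; [exact: cst_continuous|exact: coord_continuous].
Qed.

Lemma closed_abs_dot_ge n (u : 'cV[R]_n) (a : R) :
  closed [set v | a <= `|dot u v|].
Proof.
apply: (@preimage_closed _ _ (fun v : 'cV[R]_n => `|dot u v|)
  [set y : R | a <= y]) => [v _|]; last exact: closed_ge.
apply: (@continuous_comp _ _ _ (dot u) Num.Def.normr).
  exact: continuous_dot.
exact: norm_continuous.
Qed.

Lemma closed_dot_ge n (u : 'cV[R]_n) (a : R) : closed [set v | a <= dot u v].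
Proof.
apply: (@preimage_closed _ _ (dot u) [set y : R | a <= y]) => [v _|].
  exact: continuous_dot.
exact: closed_ge.
Qed.

Lemma closed_dot_le n (u : 'cV[R]_n) (a : R) : closed [set v | dot u v <= a].
Proof.
apply: (@preimage_closed _ _ (dot u) [set y : R | y <= a]) => [v _|].
  exact: continuous_dot.
exact: closed_le.
Qed.

Lemma closed_slice n (W : set 'cV[R]_n) e (c h : 'cV[R]_n) : closed W ->
  closed (slice W e c h).
Proof.
move=> cW; rewrite (_ : slice W e c h =
  [set v | dot h c <= dot h v] `&` [set v | dot h v <= dot h c + e] `&` W).
  by apply: closedI => //; apply: closedI; [exact: closed_dot_ge|exact: closed_dot_le].
rewrite /slice; congr (_ `&` _).
by apply/seteqP; split => v /=; [move=> /andP|move=> [-> ->]].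
Qed.

Lemma continuous_vec_mx p q :
  continuous (vec_mx : 'rV[R]_(p * q) -> 'M[R]_(p, q)).
Proof.
move=> u A /nbhs_ballP[e /= e0 eA].
apply/nbhs_ballP; exists e => //= v [_ uv]; apply: eA; split => // i j.
by apply: (le_lt_trans _ (uv 0 (mxvec_index i j))); rewrite !mxE.
Qed.

(** The ball is the continuous image under [vec_mx] of a max-norm ball of row vectors, which is
    closed and bounded. *)
Lemma compact_mx_ball p q (c : R) :
  compact [set A : 'M[R]_(p, q) | `|A| <= c].
Proof.
have -> : [set A : 'M[R]_(p, q) | `|A| <= c] =
    @vec_mx R p q @` [set v | `|v| <= c].
  apply/seteqP; split => [A /= Ac|_ [v /= vc <-]].
    exists (mxvec A); last exact: mxvecK.
    apply: mx_norm_le => [|i j]; first exact: le_trans Ac.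
    case/mxvec_indexP: j => k l; rewrite (ord1 i) mxvecE.
    by apply: le_trans Ac; exact: mx_entry_le.
  apply: mx_norm_le => [|i j]; first exact: le_trans vc.
  by rewrite mxE; apply: le_trans vc; exact: mx_entry_le.
apply: continuous_compact.
  exact/continuous_subspaceT/continuous_vec_mx.
apply: bounded_closed_compact.
  by exists c; split; [exact: num_real|move=> M cM v /= vc; exact: le_trans (ltW cM)].
apply: (@preimage_closed _ _ (fun v : 'rV[R]_(p * q) => `|v|)
  [set x : R | x <= c]) => [x _|]; last exact: closed_le.
exact: norm_continuous.
Qed.

End Vectors.

(** * Borel measurability of random vectors through their coordinates *)

Section RandomVectors.
Context {R : realType} {d : measure_display} {Omega : measurableType d}.

Lemma borel_open n (U : set 'cV[R]_n) : open U -> borel U.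
Proof. exact: sub_sigma_algebra. Qed.

Lemma borel_setC n (U : set 'cV[R]_n) : borel U -> borel (~` U).
Proof. exact: sigma_algebraC. Qed.

Lemma borel_closed n (U : set 'cV[R]_n) : closed U -> borel U.
Proof.
move=> cU; rewrite -(setCK U); apply: borel_setC; apply: borel_open.
exact: closed_openC.
Qed.

Lemma random_vector_coord n (X : Omega -> 'cV[R]_n) i : random_vector X ->
  measurable_fun setT (fun om => X om i 0).
Proof.
move=> rX; apply: (measurability _ (RGenOpens.measurableE R)) => //.
move=> _ [_ [a [b ->] <-]]; rewrite setTI.
apply: (rX ((fun M : 'cV[R]_n => M i 0) @^-1` `]a, b[)).
apply: borel_open; apply: open_comp; last exact: interval_open.
by move=> M _; exact: coord_continuous.
Qed.

(* Second countability: an open set is the union of the max-norm balls with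
   rational centre and radius 1/k that it contains. *)
Lemma random_vectorP n (X : Omega -> 'cV[R]_n) :
  (forall i, measurable_fun setT (fun om => X om i 0)) -> random_vector X.
Proof.
move=> mX; have mball (q : 'cV[R]_n) (e : R) : 0 < e ->
    measurable [set om | `|X om - q| < e].
  move=> e0; have -> : [set om | `|X om - q| < e] =
      \bigcap_(i : 'I_n) [set om | `|X om i 0 - q i 0| < e].
    apply/seteqP; split => om /=.
      move=> h i _ /=; apply: le_lt_trans h.
      by have := mx_entry_le _ _ (X om - q) i 0; rewrite !mxE.
    move=> h; rewrite [ltLHS]/Num.Def.normr/= mx_normrE.
    by apply/bigmax_ltP; split => // -[i j] _ /=; rewrite (ord1 j) !mxE; exact: h.
  apply: fin_bigcap_measurable; first exact: finite_finset.
  move=> i _; rewrite (_ : [set _ | _] = (fun om => X om i 0) @^-1` ball (q i 0) e).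
    by rewrite -[X in measurable X]setTI; apply: mX => //; exact: measurable_ball.
  by apply/seteqP; split => om /=; rewrite /ball/= distrC.
have mopen (U : set 'cV[R]_n) : open U -> measurable (X @^-1` U).
  move=> oU.
  pose q (a : 'cV[rat]_n) : 'cV[R]_n := map_mx ratr a.
  pose B (ak : 'cV[rat]_n * nat) : set 'cV[R]_n :=
    [set v | `|v - q ak.1| < ak.2.+1%:R^-1].
  pose F ak := if `[< B ak `<=` U >] then X @^-1` B ak else set0.
  have -> : X @^-1` U = \bigcup_ak F ak.
    apply/seteqP; split => om /=; last first.
      by move=> [ak _]; rewrite /F; case: ifPn => // /asboolP; apply.
    move=> Uom; have /nbhs_ballP[e /= e0 eU] : nbhs (X om) U by exact: open_nbhs_nbhs.
    have [k _ /(_ k (leqnn _)) ke] := near_infty_natSinv_lt (PosNum (divr_gt0 e0 (ltr0n R 2))).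
    have k0 : 0 < k.+1%:R^-1 :> R by rewrite invr_gt0.
    set eps : R := k.+1%:R^-1 in ke k0.
    have /choice[a aP] : forall i, exists r : rat, `|X om i 0 - ratr r| < eps.
      move=> i; have [|r] := @rat_in_itvoo R (X om i 0 - eps) (X om i 0 + eps).
        by lra.
      rewrite in_itv/= => /andP[r1 r2]; exists r; rewrite ltr_norml; lra.
    have Xa : B (\col_i a i, k) (X om).
      rewrite /B/= [ltLHS]/Num.Def.normr/= mx_normrE.
      apply/bigmax_ltP; split => // -[i j] _ /=; rewrite (ord1 j) !mxE.
      exact: aP.
    exists (\col_i a i, k) => //; rewrite /F; case: ifPn => // /asboolP[].
    move=> v; rewrite /B/= => va; apply: eU; rewrite mx_norm_ball /ball_/=.
    rewrite (_ : X om - v = (X om - q (\col_i a i)) - (v - q (\col_i a i))); last first.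
      by rewrite opprB addrA subrK.
    apply: le_lt_trans (ler_normB _ _) _; move: ke Xa va; rewrite /B/= -/eps.
    by set x := `|_|; set y := `|_|; lra.
  apply: countable_bigcupT_measurable; first exact: countableP.
  move=> ak; rewrite /F; case: ifP => // _.
  by rewrite /B; apply: (mball (q ak.1)); rewrite invr_gt0.
move=> B; rewrite /borel => sB.
suff : image_set_system setT X measurable B by rewrite /image_set_system/= setTI.
move: B sB; apply: smallest_sub.
  exact/sigma_algebra_image/sigma_algebra_measurable.
by move=> U oU; rewrite /image_set_system/= setTI; exact: mopen.
Qed.

Lemma random_vector_affine n m (A : 'M[R]_(n, m)) (X : Omega -> 'cV[R]_n)
    (Y : Omega -> 'cV[R]_m) :
  random_vector X -> random_vector Y ->
  random_vector (fun om => X om - A *m Y om).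
Proof.
move=> rX rY; apply: random_vectorP => i.
under eq_fun do rewrite mxE; apply: measurable_funD.
  exact: random_vector_coord.
under eq_fun do rewrite !mxE; apply: measurable_funN.
apply: measurable_sum => j; apply: measurable_funM => //.
exact: random_vector_coord.
Qed.

Lemma random_vector_col_mx n m (X : Omega -> 'cV[R]_n) (Y : Omega -> 'cV[R]_m) :
  random_vector X -> random_vector Y ->
  random_vector (fun om => col_mx (X om) (Y om)).
Proof.
move=> rX rY; apply: random_vectorP => i.
under eq_fun do rewrite mxE; case: (fintype.split i) => j.
  exact: random_vector_coord.
exact: random_vector_coord.
Qed.

End RandomVectors.

(** * Measurability of the event that the diameter is large *)

Section DiamMeasurable.
Context {R : realType}.

Lemma rat_dense_mx p q (A : 'M[R]_(p, q)) (V : set 'M[R]_(p, q)) : nbhs A V ->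
  exists a : 'M[rat]_(p, q), V (map_mx ratr a).
Proof.
move=> /nbhs_ballP[e /= e0 eV].
have /choice[a aP] : forall ij : 'I_p * 'I_q, exists r : rat,
    `|A ij.1 ij.2 - ratr r| < e.
  move=> ij; have [|r] := @rat_in_itvoo R (A ij.1 ij.2 - e) (A ij.1 ij.2 + e).
    by lra.
  rewrite in_itv/= => /andP[r1 r2]; exists r; rewrite ltr_norml; lra.
exists (\matrix_(i, j) a (i, j)); apply: eV; split => // i j.
by rewrite !mxE /ball/=; exact: (aP (i, j)).
Qed.

Lemma continuous_sub_mulmx p q (x : 'cV[R]_p) (z : 'cV[R]_q) :
  continuous (fun A : 'M[R]_(p, q) => x - A *m z).
Proof.
move=> A V /nbhs_ballP[e /= e0 eV].
have c0 : 0 < q%:R * `|z| + 1 by apply: ltr_wpDl => //; exact: mulr_ge0.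
apply/nbhs_ballP; exists (e / (q%:R * `|z| + 1)); first exact: divr_gt0.
move=> B; rewrite mx_norm_ball /ball_/= => AB.
apply: eV; rewrite mx_norm_ball /ball_/=.
rewrite (_ : _ - _ = (B - A) *m z); last first.
  by rewrite mulmxBl opprB addrC addrA subrK.
apply: le_lt_trans (mulmx_norm_le _ _ _ _) _.
rewrite [_ * `|B - A|]mulrC -mulrA distrC.
have h : `|A - B| * (q%:R * `|z| + 1) < e by rewrite -ltr_pdivlMr.
apply: le_lt_trans h.
by rewrite ler_wpM2l// lerDl.
Qed.

Lemma compact_seq_cluster (T : topologicalType) (K : set T) (u : nat -> T) :
  compact K -> (forall j, K (u j)) ->
  exists2 x, K x & forall V, nbhs x V -> forall J, exists2 j, (J <= j)%N & V (u j).
Proof.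
move=> cK Ku; have [|x [Kx clx]] := cK (u @ \oo) _ _.
  by exists 0%N => // j _; exact: Ku.
exists x => // V nV J.
have [|y [[j Jj <-] Vy]] := clx (u @` [set j | (J <= j)%N]) V _ nV; last by exists j.
by exists J => // j Jj; exists j.
Qed.

Lemma continuous_norm2_sub p q :
  continuous (fun N : 'M[R]_(p, q) * 'M[R]_(p, q) => norm2 (N.1 - N.2)).
Proof.
move=> N; apply: continuous_comp; last exact: continuous_norm2.
by apply: cvgB; [exact: cvg_fst|exact: cvg_snd].
Qed.

(* The value of a measure on a non-measurable set is arbitrary, so this cannot
   be avoided.  The event is a projection; compactness of W and of bounded sets
   of pairs of matrices reduces it to rational pairs that are feasible up to an
   arbitrarily small error. *)
Lemma measurable_diam_gt d (Omega : measurableType d) (p q T : nat)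
    (W : set 'cV[R]_p) (x : nat -> Omega -> 'cV[R]_p)
    (z : nat -> Omega -> 'cV[R]_q) (delta : R) :
  compact W -> (forall t, random_vector (x t)) -> (forall t, random_vector (z t)) ->
  measurable [set om | (delta%:E < diam [set A : 'M[R]_(p, q) |
    forall t, (t < T)%N -> W (x t om - A *m z t om)%R])%E].
Proof.
move=> cW rx rz.
(* Open neighbourhoods shrinking to W: a rational matrix close to a feasible one satisfies the
   relaxed constraints, though perhaps not the exact ones. *)
pose nhb j : set 'cV[R]_p := \bigcup_(y in W) ball y (j.+1%:R^-1 : R).
have jp j : 0 < j.+1%:R^-1 :> R by rewrite invr_gt0.
have nhb_open j : open (nhb j).
  by apply: bigcup_open => y _; exact: ball_open.
pose ok (om : Omega) j (A : 'M[R]_(p, q)) :=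
  forall t, (t < T)%N -> nhb j (x t om - A *m z t om).
(* A single index n bounds both matrices, for compactness, and quantifies the strict inequality so
   that it survives a limit. *)
pose C n (A B : 'M[R]_(p, q)) :=
  [/\ `|A| <= n%:R, `|B| <= n%:R & delta + n.+1%:R^-1 <= norm2 (A - B)].
pose E n j (ab : 'M[rat]_(p, q) * 'M[rat]_(p, q)) : set Omega :=
  if `[< C n (map_mx ratr ab.1) (map_mx ratr ab.2) >] then
    [set om | ok om j (map_mx ratr ab.1)] `&` [set om | ok om j (map_mx ratr ab.2)]
  else set0.
have mok j A : measurable [set om | ok om j A].
  rewrite (_ : [set _ | _] = \bigcap_(t in [set t | (t < T)%N])
      (fun om => x t om - A *m z t om) @^-1` nhb j)//.
  apply: bigcap_measurableType => t _.
  by apply: random_vector_affine => //; exact: borel_open.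
suff -> : [set om | (delta%:E < diam [set A : 'M[R]_(p, q) |
    forall t, (t < T)%N -> W (x t om - A *m z t om)%R])%E] =
    \bigcup_n \bigcap_j \bigcup_ab E n j ab.
  apply: bigcupT_measurable => n; apply: bigcapT_measurable => j.
  apply: countable_bigcupT_measurable; first exact: countableP.
  by move=> ab; rewrite /E; case: ifP => // _; exact: measurableI.
apply/seteqP; split => om.
  move=> /= /ereal_sup_gt[_ [[A B] /= [hA hB] <-]]; rewrite lte_fin => dAB.
  have gap : 0 < norm2 (A - B) - delta by rewrite subr_gt0.
  have [k _ /(_ k (leqnn _)) ke] := near_infty_natSinv_lt (PosNum gap).
  (* Large enough for the unit balls around A and B to stay within norm n, and for 1/(n + 1) to lie
     below the gap. *)
  pose n := (k + (Num.truncn `|A|).+2 + (Num.truncn `|B|).+2)%N.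
  have nA : `|A| + 1 < n%:R.
    have := truncnS_gt `|A|; rewrite /n !natrD -(natr1 (Num.truncn `|A|).+1).
    have := ler0n R k; have := ler0n R (Num.truncn `|B|).+2; lra.
  have nB : `|B| + 1 < n%:R.
    have := truncnS_gt `|B|; rewrite /n !natrD -(natr1 (Num.truncn `|B|).+1).
    have := ler0n R k; have := ler0n R (Num.truncn `|A|).+2; lra.
  have nd : delta + n.+1%:R^-1 < norm2 (A - B).
    rewrite -ltrBrDl; apply: le_lt_trans ke.
    by rewrite lef_pV2 ?posrE// ler_nat ltnS /n -addnA leq_addr.
  exists n => // j _.
  pose near_ok (M : 'M[R]_(p, q)) := [set N : 'M[R]_(p, q) | `|N| <= n%:R /\ ok om j N].
  have nearP M : `|M| + 1 < n%:R ->
      (forall t, (t < T)%N -> W (x t om - M *m z t om)) -> nbhs M (near_ok M).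
    move=> Mn hM; apply: filterI.
      apply/nbhs_ballP; exists 1 => //= N; rewrite mx_norm_ball /ball_/= => MN.
      rewrite -[N](subrK M); apply: le_trans (ler_normD _ _) _.
      by rewrite distrC; lra.
    have : forall t : 'I_T, \forall N \near M, nhb j (x t om - N *m z t om).
      move=> t; apply: (continuous_sub_mulmx _ _ (x t om) (z t om) M).
      apply: open_nbhs_nbhs; split=> //.
      by exists (x t om - M *m z t om); [exact: hM|exact: ballxx].
    move=> /filter_forall; apply: filterS => N hN t tT.
    exact: (hN (Ordinal tT)).
  have nrm : \forall N \near (A, B), delta + n.+1%:R^-1 < norm2 (N.1 - N.2).
    exact: (continuous_norm2_sub _ _ (A, B) _
      (open_nbhs_nbhs (conj (@open_gt R _) nd))).
  case: nrm => -[V1 V2] /= [nV1 nV2] V12.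
  have [a [[an aok] aV]] := rat_dense_mx _ _ A _ (filterI (nearP A nA hA) nV1).
  have [b [[bn bok] bV]] := rat_dense_mx _ _ B _ (filterI (nearP B nB hB) nV2).
  exists (a, b) => //; rewrite /E/=; case: ifPn => // /asboolP[]; split => //.
  by apply/ltW/(V12 (_, _)).
(* Conversely, one rational pair per tolerance 1/(j + 1) gives a sequence in a compact set; its
   cluster point is feasible because W is closed, and keeps the gap 1/(n + 1). *)
move=> [n _ h].
have /choice[ab abP] : forall j, exists ab, E n j ab om.
  by move=> j; have [ab _ ?] := h j Logic.I; exists ab.
pose u j : 'M[R]_(p, q) * 'M[R]_(p, q) :=
  (map_mx ratr (ab j).1, map_mx ratr (ab j).2).
have uC j : C n (u j).1 (u j).2.
  by have := abP j; rewrite /E; case: ifPn => // /asboolP.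
have uok j : ok om j (u j).1 /\ ok om j (u j).2.
  by have := abP j; rewrite /E; case: ifPn.
have cK : compact ([set A : 'M[R]_(p, q) | `|A| <= n%:R] `*`
    [set A : 'M[R]_(p, q) | `|A| <= n%:R]).
  by apply: compact_setX; exact: compact_mx_ball.
have [|[A B] _ cl] := compact_seq_cluster _ _ u cK.
  by move=> j; have [? ? _] := uC j; split.
have cWl : closed W by apply: compact_closed cW; exact: norm_hausdorff.
have inW (M : 'M[R]_(p, q)) (f : nat -> 'M[R]_(p, q)) :
    (forall V, nbhs M V -> forall J, exists2 j, (J <= j)%N & V (f j)) ->
    (forall j, ok om j (f j)) ->
    forall t, (t < T)%N -> W (x t om - M *m z t om).
  move=> clM fok t tT; apply: cWl => V /nbhs_ballP[e /= e0 eV].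
  have e20 : 0 < e / 2 by rewrite divr_gt0.
  have [J _ /(_ J (leqnn _)) Je] := near_infty_natSinv_lt (PosNum e20).
  have nM : nbhs M [set N | ball (x t om - M *m z t om) (e / 2) (x t om - N *m z t om)].
    apply: (continuous_sub_mulmx _ _ (x t om) (z t om) M).
    exact: nbhsx_ballx.
  have [j Jj fj] := clM _ nM J.
  have [y Wy by_] := fok j t tT.
  exists y; split => //; apply: eV.
  have -> : e = e / 2 + e / 2 by rewrite -splitr.
  apply: ball_triangle fj _; apply: ball_sym.
  apply: le_ball by_; apply: le_trans (ltW Je).
  by rewrite lef_pV2 ?posrE// ler_nat ltnS.
apply/ereal_sup_gtP; exists (norm2 (A - B))%:E.
  exists (A, B) => //=; split.
    apply: (inW _ (fun j => (u j).1)); last by move=> j; have [] := uok j.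
    move=> V nV J; have [|j Jj Vj] := cl (V `*` setT) _ J; last by exists j => //; case: Vj.
    by exists (V, setT) => //=; split => //; exact: filterT.
  apply: (inW _ (fun j => (u j).2)); last by move=> j; have [] := uok j.
  move=> V nV J; have [|j Jj Vj] := cl (setT `*` V) _ J; last by exists j => //; case: Vj.
  by exists (setT, V) => //=; split => //; exact: filterT.
rewrite lte_fin; apply: (@lt_le_trans _ _ (delta + n.+1%:R^-1)); first by rewrite ltrDl.
rewrite leNgt; apply/negP => lt.
have [j _] := cl _ (continuous_norm2_sub _ _ (A, B) _
  (open_nbhs_nbhs (conj (@open_lt R _) lt))) 0%N.
by have [_ _] := uC j; rewrite /= leNgt => /negP.
Qed.

End DiamMeasurable.

(** * Nets of unit matrices and directions given by supporting half-spaces *)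

Section Directions.
Context {R : realType}.

(** Here [rho] is the Frobenius inner product of X with U, so [rho *: U] is the projection of X and
    the squared error is 1 - rho^2 <= v^2. As rho <= 1, also rho >= rho^2 >= 1 - v^2. *)
Lemma sphere_net_mx p q (v : R) : 0 < v < 1 ->
  exists S : seq 'M[R]_(p, q),
    [/\ (size S)%:R <= (6 + 3 / v) ^+ (p * q),
        (forall U, U \in S -> norm2 U = 1)
      & (forall X : 'M[R]_(p, q), norm2 X = 1 ->
        exists2 U, U \in S & exists rho : R,
          [/\ 0 < rho <= 1, 1 - v ^+ 2 <= rho & norm2 (X - rho *: U) <= v])].
Proof.
move=> v01; have /andP[v0 v1] := v01.
have [S [sS S1 Sn]] := @sphere_net R ('I_p * 'I_q)%type v v01.
pose mx (f : {ffun 'I_p * 'I_q -> R}) : 'M[R]_(p, q) := \matrix_(i, j) f (i, j).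
have mxE2 f : \sum_(k : 'I_p * 'I_q) mx f k.1 k.2 ^+ 2 = \sum_k f k ^+ 2.
  by apply: eq_bigr => -[i j] _; rewrite mxE.
exists [seq mx f | f <- S]; split.
- by rewrite size_map; apply: le_trans sS _; rewrite card_prod !card_ord.
- move=> _ /mapP[f fS ->]; apply/eqP; rewrite -(@eqrXn2 _ 2) ?norm2_ge0//.
  by rewrite expr1n norm2_sqr mxE2 S1.
move=> X X1.
have Xs : \sum_(k : 'I_p * 'I_q) X k.1 k.2 ^+ 2 = 1 by rewrite -norm2_sqr X1 expr1n.
have [u [uS r0 r1]] := Sn (fun k => X k.1 k.2) Xs.
set rho := \sum_i _ in r0 r1.
exists (mx u); first by apply/mapP; exists u.
have rho1 : rho <= 1.
  apply: ler_of_sqr => //; rewrite expr1n.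
  by apply: le_trans (cauchy_schwarz_sum _ _ _) _; rewrite Xs S1// mul1r.
exists rho; split; first by rewrite r0.
  by apply: le_trans r1 _; rewrite expr2 ger_pMl.
apply: ler_of_sqr; first exact: ltW.
have E : norm2 (X - rho *: mx u) ^+ 2 = 1 - rho ^+ 2.
  rewrite norm2_sqr.
  under eq_bigr => k _.
    rewrite !mxE (_ : _ ^+ 2 = X k.1 k.2 ^+ 2 - 2 * rho * (X k.1 k.2 * u k) +
      rho ^+ 2 * u k ^+ 2); first over.
    by rewrite -surjective_pairing; ring.
  by rewrite !big_split/= sumrN -!mulr_sumr Xs S1// -/rho; ring.
by rewrite E; lra.
Qed.

Lemma exists_unit_vector n : (0 < n)%N -> exists e : 'cV[R]_n, norm2 e = 1.
Proof.
case: n => // n _; exists (delta_mx 0 0); apply/eqP.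
rewrite -(@eqrXn2 _ 2) ?norm2_ge0// norm2_sqr_cV (bigD1 ord0)//= !mxE eqxx.
rewrite big1 ?addr0// => i i0.
by rewrite mxE (negbTE i0) expr0n.
Qed.

Section Supporting.
Variables (n : nat) (W : set 'cV[R]_n) (I : Type) (c h : I -> 'cV[R]_n).
Hypothesis n0 : (0 < n)%N.
Hypothesis W_interior : interior W !=set0.
Hypothesis c_supp : forall i, supporting W (c i) (h i).
Hypothesis K_compact : compact (\bigcap_(i in [set: I]) halfspace (c i) (h i)).

Let h1 i : norm2 (h i) = 1. Proof. by have [] := c_supp i. Qed.

(* If h_i . x were small for all i, one could move far from an interior point
   of W in direction -x without leaving the intersection of half-spaces. *)
Lemma support_gap : exists2 e : R, 0 < e &
  forall x : 'cV[R]_n, norm2 x = 1 -> exists i, e <= dot (h i) x.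
Proof.
have [w0 /nbhs_ballP[r /= r0 rW]] := W_interior.
(* Moving by r/2 from [w0] against [h i] stays in W, hence in the half-space. *)
have gap i : r / 2 <= dot (h i) w0 - dot (h i) (c i).
  have [_ _ /(_ (w0 - (r / 2) *: h i))] := c_supp i.
  rewrite /halfspace/= dotBr dotZr dot_self h1 expr1n mulr1 => Wc.
  rewrite lerBrDl addrC -lerBrDl; apply: Wc; apply: rW.
  rewrite mx_norm_ball /ball_/= opprB addrC subrK.
  apply: le_lt_trans (mx_norm_le_norm2 _ _ _) _.
  by rewrite norm2Z h1 gtr0_norm; lra.
have [M [Mreal KM]] := compact_bounded K_compact.
pose M1 := `|M| + 1.
have KM1 v : (\bigcap_(i in [set: I]) halfspace (c i) (h i)) v -> `|v| <= M1.
  by apply: KM; rewrite /M1; have := ler_norm M; lra.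
(* A Euclidean unit vector has max norm at least 1/n, so a step of length [s] leaves the ball of
   radius [M1] that contains the intersection. *)
pose s : R := n%:R * (M1 + `|w0| + 1).
have M10 : 0 < M1 by rewrite /M1; have := normr_ge0 M; lra.
have s0 : 0 < s.
  by rewrite mulr_gt0// ?ltr0n//; have := normr_ge0 w0; lra.
exists (r / 2 / s); first by rewrite !divr_gt0.
move=> x x1.
have xn : 1 <= n%:R * `|x|.
  have x2 : \sum_(i < n) x i 0 ^+ 2 = 1 by rewrite -norm2_sqr_cV x1 expr1n.
  have xle : `|x| <= 1 by rewrite -x1; exact: mx_norm_le_norm2.
  rewrite -{1}x2; apply: (@le_trans _ _ (\sum_(i < n) `|x|)).
    apply: ler_sum => i _; rewrite -real_normK ?num_real// expr2.
    have xi := mx_entry_le _ _ x i 0.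
    by apply: (le_trans _ xi); rewrite ler_piMl//; exact: le_trans xi xle.
  by rewrite sumr_const card_ord mulr_natl.
have : ~ (\bigcap_(i in [set: I]) halfspace (c i) (h i)) (w0 - s *: x).
  move=> /KM1; apply/negP; rewrite -ltNge.
  have : s * `|x| <= `|w0 - s *: x| + `|w0|.
    rewrite -[s in s * _](gtr0_norm s0) -normrZ distrC.
    by have := ler_normD (s *: x - w0) w0; rewrite subrK.
  have : M1 + `|w0| + 1 <= s * `|x|.
    rewrite /s -mulrA mulrCA -[leLHS]mulr1 ler_pM2l//.
    by have := normr_ge0 w0; lra.
  lra.
move=> /existsNP[i /not_implyP[_ /negP]]; rewrite -ltNge dotBr dotZr => hi.
exists i; rewrite ler_pdivrMr// mulrC; have := gap i; lra.
Qed.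

(** An empty family would have the whole space, not compact, as its intersection of half-spaces.
    With an index at hand, the suprema in [minmax_dot] are genuine and not default values. *)
Let I_inhabited : exists i0 : I, True.
Proof.
have [e _ he] := support_gap; have [x /he[i _]] := exists_unit_vector n n0.
by exists i.
Qed.

Let dot_h_le x : norm2 x = 1 -> forall i, -1 <= dot (h i) x <= 1.
Proof.
by move=> x1 i; rewrite -ler_norml; have := dot_le _ (h i) x; rewrite h1 x1 mul1r.
Qed.

Let has_sup_dot x : norm2 x = 1 ->
  has_sup [set dot (h i) x | i in [set: I]].
Proof.
move=> x1; have [i0 _] := I_inhabited; split; first by exists (dot (h i0) x), i0.
by exists 1 => _ [i _ <-]; have /andP[] := dot_h_le x x1 i.
Qed.

Lemma minmax_dot_gt0 : 0 < minmax_dot h.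
Proof.
have [e e0 he] := support_gap; apply: lt_le_trans e0 _.
apply: lb_le_inf.
  have [x x1] := exists_unit_vector n n0.
  by exists (sup [set dot (h i) x | i in [set: I]]), x.
move=> _ [x /= x1 <-]; have [i hi] := he x x1.
apply: le_trans hi _; apply: ub_le_sup; first by have [] := has_sup_dot x x1.
by exists i.
Qed.

(** The slack [e] is there because the supremum over an infinite family need not be attained. *)
Lemma minmax_dot_lt x e : norm2 x = 1 -> 0 < e ->
  exists i, minmax_dot h - e < dot (h i) x.
Proof.
move=> x1 e0; have [_ [i _ <-] hi] := sup_adherent e0 (has_sup_dot x x1).
exists i; apply: le_lt_trans hi; rewrite lerD2r; apply: ge_inf; last by exists x.
exists (-1) => _ [y /= y1 <-]; have [i0 _] := I_inhabited.
have /andP[lb _] := dot_h_le y y1 i0; apply: le_trans lb _.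
by apply: ub_le_sup; [have [] := has_sup_dot y y1|exists i0].
Qed.

Lemma minmax_dot_le1 : minmax_dot h <= 1.
Proof.
have [x x1] := exists_unit_vector n n0; apply/ler_addgt0Pr => e e0.
have [i hi] := minmax_dot_lt x e x1 e0; have /andP[_] := dot_h_le x x1 i.
by move: hi; lra.
Qed.

(* Avoids a measurable choice of the direction when I is infinite. *)
Lemma finite_directions : exists N (f : 'I_N -> I), forall y : 'cV[R]_n,
  exists k, 4 / 5 * minmax_dot h * norm2 y <= dot (h (f k)) y.
Proof.
set xi := minmax_dot h; have xi0 : 0 < xi := minmax_dot_gt0.
have xi1 : xi <= 1 := minmax_dot_le1.
(* This radius serves both as net radius and as slack in the supremum; the total loss is small
   enough that (1 - v^2)(xi - v) - v >= 4/5 xi. *)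
pose v := xi / 20; have v01 : 0 < v < 1 by rewrite /v; apply/andP; split; lra.
have v0 : 0 < v by have /andP[] := v01.
have [S [_ S1 Sn]] := sphere_net_mx n 1 v v01.
have /choice[f fP] : forall k : 'I_(size S), exists i,
    xi - v < dot (h i) (tnth (in_tuple S) k).
  by move=> k; apply: minmax_dot_lt => //; apply: S1; exact: mem_tnth.
exists (size S), f => y.
have unit_case (x : 'cV[R]_n) : norm2 x = 1 ->
    exists k, 4 / 5 * xi <= dot (h (f k)) x.
  move=> /Sn[u uS [rho [/andP[r0 r1] rv xu]]].
  have /tnthP[k ku] : u \in in_tuple S by [].
  exists k; have := fP k; rewrite -ku => hu.
  have := dot_le _ (h (f k)) (x - rho *: u); rewrite h1 mul1r dotBr dotZr.
  rewrite ler_norml => /andP[hl _].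
  have hr : rho * (xi - v) <= rho * dot (h (f k)) u by rewrite ler_pM2l// ltW.
  have hv : (1 - v ^+ 2) * (xi - v) <= rho * (xi - v).
    by rewrite ler_wpM2r// /v; lra.
  have hq : 4 / 5 * xi <= (1 - v ^+ 2) * (xi - v) - v.
    have : v ^+ 2 <= 1 / 400 by rewrite /v; nra.
    by rewrite /v; nra.
  by lra.
have [y0|yn] := eqVneq y 0.
  have [x x1] := exists_unit_vector n n0; have [k _] := unit_case x x1.
  exists k; rewrite y0 /dot mulmx0 mxE.
  by rewrite (_ : norm2 0 = 0) ?mulr0// -(scale0r 0) norm2Z normr0 mul0r.
have ny : 0 < norm2 y.
  rewrite lt_neqAle norm2_ge0 andbT eq_sym; apply: contra yn => /eqP.
  by move=> /norm2_eq0 ->.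
have [|k hk] := unit_case ((norm2 y)^-1 *: y).
  by rewrite norm2Z gtr0_norm ?invr_gt0// mulVf ?gt_eqF.
by exists k; move: hk; rewrite dotZr mulrC [leRHS]mulrC ler_pdivlMr// mulrC.
Qed.

End Supporting.
End Directions.

(** * From hits in net directions to excitation in all directions *)

Section Excitation.
Context {R : realType}.

(** A unit vector is [rho *: u] up to an error that contributes at most v b = sigma p / 16 to each
    product, while at least L p / 2 instants have size sigma along [u]. The bound is on a sum of
    squares so that it adds up over the rows of a matrix. *)
Lemma excitation_vector q (sigma p b : R) (s L r : nat) (zeta : nat -> 'cV[R]_q)
    (S : seq 'cV[R]_q) (lam : 'cV[R]_q) :
  0 < sigma -> 0 < p <= 1 -> sigma <= b ->
  (forall t, (s <= t < s + L)%N -> norm2 (zeta t) <= b) ->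
  (forall X : 'cV[R]_q, norm2 X = 1 -> exists2 U, U \in S & exists rho : R,
    [/\ 0 < rho <= 1, 1 - (sigma * p / (16 * b)) ^+ 2 <= rho &
        norm2 (X - rho *: U) <= sigma * p / (16 * b)]) ->
  L%:R * p / 2 <= r%:R ->
  (forall u, u \in S ->
    (r <= \sum_(s <= t < s + L) (sigma <= `|dot u (zeta t)|)%R)%N) ->
  L%:R * (5 / 8 * sigma * p) ^+ 2 * norm2 lam ^+ 2 <=
    \sum_(s <= t < s + L) dot lam (zeta t) ^+ 2.
Proof.
move=> sg0 /andP[p0 p1] sb zb net rL hit.
have b0 : 0 < b by exact: lt_le_trans sb.
set v := sigma * p / (16 * b) in net.
have v0 : 0 < v by rewrite divr_gt0 ?mulr_gt0.
have vb : v * b = sigma * p / 16 by rewrite /v; field; rewrite gt_eqF.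
have v16 : v <= 1 / 16.
  rewrite /v ler_pdivrMr ?mulr_gt0//.
  by apply: le_trans (_ : sigma * p <= sigma * 1) _; rewrite ?ler_pM2l//; lra.
have unit_case (X : 'cV[R]_q) : norm2 X = 1 ->
    L%:R * (5 / 8 * sigma * p) ^+ 2 <= \sum_(s <= t < s + L) dot X (zeta t) ^+ 2.
  move=> /net[u uS [rho [/andP[r0 r1] rv Xu]]].
  have rho2 : 99 / 100 <= rho ^+ 2.
    have : 255 / 256 <= rho by apply: le_trans rv; nra.
    nra.
  have step t : (s <= t < s + L)%N ->
      9 / 10 * rho ^+ 2 * (sigma ^+ 2 * (sigma <= `|dot u (zeta t)|)%R%:R) -
      9 * (sigma * p / 16) ^+ 2 <= dot X (zeta t) ^+ 2.
    move=> /zb zt; set a := dot u (zeta t).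
    have hX : dot X (zeta t) = rho * a + dot (X - rho *: u) (zeta t).
      by rewrite ![dot _ (zeta t)]dotC dotBr dotZr /a [dot u _]dotC addrC subrK.
    set e := dot (X - rho *: u) (zeta t) in hX.
    have e2 : e ^+ 2 <= (sigma * p / 16) ^+ 2.
      have ev : `|e| <= v * b.
        apply: le_trans (dot_le _ _ _) _.
        by apply: ler_pM => //; exact: norm2_ge0.
      rewrite -vb -(real_normK (num_real e)) lerXn2r// nnegrE.
      by rewrite mulr_ge0// ltW.
    have a2 : sigma ^+ 2 * (sigma <= `|a|)%R%:R <= a ^+ 2.
      case: (leP sigma `|a|) => sa; last by rewrite mulr0 sqr_ge0.
      by rewrite mulr1 -(real_normK (num_real a)) lerXn2r// nnegrE ltW.
    (* (rho a + e)^2 >= 9/10 (rho a)^2 - 9 e^2 *)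
    have : 9 / 10 * rho ^+ 2 * (sigma ^+ 2 * (sigma <= `|a|)%R%:R) <=
        9 / 10 * rho ^+ 2 * a ^+ 2.
      by rewrite ler_wpM2l// mulr_ge0// ?sqr_ge0.
    have := sqr_ge0 (rho * a + 10 * e); rewrite hX.
    set m := 9 / 10 * _ * (_ * _); set w := (sigma * p / 16) ^+ 2 in e2 *.
    by nra.
  have : \sum_(s <= t < s + L) (9 / 10 * rho ^+ 2 *
      (sigma ^+ 2 * (sigma <= `|dot u (zeta t)|)%R%:R) -
      9 * (sigma * p / 16) ^+ 2) <= \sum_(s <= t < s + L) dot X (zeta t) ^+ 2.
    by apply: ler_sum_nat => t; exact: step.
  apply: le_trans; rewrite big_split/= -!mulr_sumr -natr_sum.
  rewrite sumr_const_nat addKn.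
  have := hit u uS; rewrite -(ler_nat R); set N : R := (\sum_(s <= t < _) _)%:R.
  move=> rN; rewrite -[- _ *+ L]mulr_natl.
  have N0 : L%:R * p / 2 <= N by exact: le_trans rL rN.
  have L0 : 0 <= L%:R :> R by [].
  move: N0 L0; set l : R := L%:R => N0 L0.
  have s2 : 0 < sigma ^+ 2 by rewrite exprn_gt0.
  have h1 : 9 / 10 * (99 / 100) * (sigma ^+ 2 * (l * p / 2)) <=
      9 / 10 * rho ^+ 2 * (sigma ^+ 2 * N).
    apply: ler_pM; rewrite ?mulr_ge0 ?ler_pM2l ?divr_ge0//; lra.
  have h2 : l * sigma ^+ 2 * p ^+ 2 <= l * sigma ^+ 2 * p.
    apply: ler_wpM2l; first by rewrite mulr_ge0// ltW.
    by rewrite expr2 ger_pMl.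
  have h3 : 0 <= l * sigma ^+ 2 * p ^+ 2 by rewrite !mulr_ge0// ltW// ?exprn_gt0.
  apply: le_trans (_ : 9 / 10 * (99 / 100) * (sigma ^+ 2 * (l * p / 2)) +
    l * - (9 * (sigma * p / 16) ^+ 2) <= _); last by rewrite lerD2r.
  have -> : l * (5 / 8 * sigma * p) ^+ 2 = 25 / 64 * (l * sigma ^+ 2 * p ^+ 2).
    by field.
  have -> : 9 / 10 * (99 / 100) * (sigma ^+ 2 * (l * p / 2)) +
      l * - (9 * (sigma * p / 16) ^+ 2) =
      891 / 2000 * (l * sigma ^+ 2 * p) - 9 / 256 * (l * sigma ^+ 2 * p ^+ 2).
    by field.
  (* Since p^2 <= p, it suffices that 891/2000 - 9/256 >= 25/64. *)
  by lra.
have [->|ln] := eqVneq lam 0.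
  rewrite (_ : norm2 0 = 0); last by rewrite -(scale0r 0) norm2Z normr0 mul0r.
  by rewrite expr0n mulr0 sumr_ge0// => t _; exact: sqr_ge0.
have nl : 0 < norm2 lam.
  rewrite lt_neqAle norm2_ge0 andbT eq_sym; apply: contra ln => /eqP.
  by move=> /norm2_eq0 ->.
have := unit_case ((norm2 lam)^-1 *: lam).
rewrite norm2Z gtr0_norm ?invr_gt0// mulVf ?gt_eqF// => /(_ erefl).
under eq_bigr do rewrite dotC dotZr exprMn exprVn dotC.
by rewrite -mulr_sumr [leRHS]mulrC ler_pdivlMr// exprn_gt0.
Qed.

(** Summing the vector bound over the rows of Y, whose squared norms add up to 1, bounds the mean of
    |Y zeta_t|^2 over the window from below, so some instant reaches it. Only a net of vectors is
    needed, which keeps the exponent of [a2] at nz. *)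
Lemma excitation_matrix l q (sigma p b : R) (s L r : nat)
    (zeta : nat -> 'cV[R]_q) (S : seq 'cV[R]_q) (Y : 'M[R]_(l, q)) :
  0 < sigma -> 0 < p <= 1 -> sigma <= b ->
  (forall t, (s <= t < s + L)%N -> norm2 (zeta t) <= b) ->
  (forall X : 'cV[R]_q, norm2 X = 1 -> exists2 U, U \in S & exists rho : R,
    [/\ 0 < rho <= 1, 1 - (sigma * p / (16 * b)) ^+ 2 <= rho &
        norm2 (X - rho *: U) <= sigma * p / (16 * b)]) ->
  L%:R * p / 2 <= r%:R ->
  (forall u, u \in S ->
    (r <= \sum_(s <= t < s + L) (sigma <= `|dot u (zeta t)|)%R)%N) ->
  (0 < L)%N -> norm2 Y = 1 ->
  exists2 t, (s <= t < s + L)%N & 5 / 8 * sigma * p <= norm2 (Y *m zeta t).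
Proof.
move=> sg0 p01 sb zb net rL hit L0 Y1; apply: contrapT => hno.
have small t : (s <= t < s + L)%N -> norm2 (Y *m zeta t) ^+ 2 < (5 / 8 * sigma * p) ^+ 2.
  move=> st; have : norm2 (Y *m zeta t) < 5 / 8 * sigma * p.
    by rewrite ltNge; apply/negP => h; apply: hno; exists t.
  by move=> h; rewrite ltrXn2r// ?nnegrE ?norm2_ge0//; apply: le_trans (ltW h); exact: norm2_ge0.
have rows t : norm2 (Y *m zeta t) ^+ 2 = \sum_i dot (row i Y)^T (zeta t) ^+ 2.
  rewrite norm2_sqr_cV; apply: eq_bigr => i _; congr (_ ^+ 2).
  by rewrite dotE mxE; apply: eq_bigr => j _; rewrite !mxE.
have : \sum_(s <= t < s + L) norm2 (Y *m zeta t) ^+ 2 <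
    \sum_(s <= t < s + L) (5 / 8 * sigma * p) ^+ 2.
  by apply: ltr_sum_nat => //; rewrite -addn1 leq_add2l.
rewrite sumr_const_nat addKn -[_ *+ L]mulr_natl ltNge => /negP; apply.
under eq_bigr do rewrite rows.
rewrite exchange_big/=.
have YE : \sum_i norm2 (row i Y)^T ^+ 2 = 1 by rewrite -norm2_sqr_rows Y1 expr1n.
rewrite -[leLHS]mulr1 -[X in _ * X <= _]YE mulr_sumr.
apply: ler_sum => i _; exact: (excitation_vector _ sigma p b s L r zeta S).
Qed.

End Excitation.

(** * Missing slices in several directions, union bound, block counting *)

Section Misses.
Context {R : realType} {d : measure_display} {Omega : measurableType d}.
Variable P : probability Omega R.

Lemma measurable_misses (K : choiceType) (Q S : K -> set Omega) (ks : seq K) :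
  (forall k, measurable (Q k)) -> (forall k, measurable (S k)) ->
  measurable [set om | forall k, k \in ks -> Q k om -> ~ S k om].
Proof.
move=> mQ mS; rewrite (_ : [set _ | _] =
  \bigcap_(k in [set` ks]) (~` Q k `|` ~` S k)); last first.
  apply/seteqP; split => om h k /= kks.
    by have [Qk|] := pselect (Q k om); [right; exact: h|left].
  by move=> Qk; have [|] := h k kks.
apply: fin_bigcap_measurable => // k _.
by apply: measurableU; exact: measurableC.
Qed.

(** Split according to the first index of the list whose [Q k] holds. This index is determined by F,
    and on each piece the miss of that single [S k] already costs the factor q. *)
Lemma misses_le (F : set (set Omega)) (K : choiceType) (Q S : K -> set Omega)
    (q : R) :
  (forall A, F A -> measurable A) ->
  (forall A B, F A -> F B -> F (A `&` B)) -> (forall A, F A -> F (~` A)) ->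
  (forall k, F (Q k)) -> (forall k, measurable (S k)) ->
  (forall k A, F A -> pr P (A `&` ~` S k) <= q * pr P A) ->
  forall (ks : seq K) A, F A ->
    A `<=` [set om | exists2 k, k \in ks & Q k om] ->
    pr P (A `&` [set om | forall k, k \in ks -> Q k om -> ~ S k om]) <=
      q * pr P A.
Proof.
move=> Fm FI FC FQ mS miss; have mQ k := Fm _ (FQ k).
elim=> [|k ks IH] A FA Asub; have mA := Fm _ FA.
  have -> : A = set0 by rewrite -subset0 => om /Asub[].
  by rewrite set0I /pr measure0 mulr0.
have mM ks' := measurable_misses K Q S ks' mQ mS.
rewrite (pr_split P _ (Q k))//; last exact: measurableI.
rewrite (pr_split P A (Q k))// mulrDr; apply: lerD.
  apply: le_trans (miss k _ (FI _ _ FA (FQ k))); apply: pr_le.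
  - by apply: measurableI => //; exact: measurableI.
  - by apply: measurableI; [exact: measurableI|exact: measurableC].
  - by move=> om /= [[Aom h] Qom]; split => //; apply: h => //; exact: mem_head.
have FA2 := FI _ _ FA (FC _ (FQ k)).
apply: le_trans (IH _ FA2 _).
  apply: pr_le.
  - apply: measurableI; [exact: measurableI|exact: measurableC].
  - by apply: measurableI => //; exact: Fm.
  - move=> om /= [[Aom h] Qom]; split => // k' k'ks.
    by apply: h; rewrite in_cons k'ks orbT.
move=> om [/Asub[k']]; rewrite in_cons => /orP[/eqP->//|k'ks] Qk' _.
by exists k'.
Qed.

Lemma pr_bigsetU_le (K : eqType) (ks : seq K) (A : K -> set Omega) (c : R) :
  (forall k, measurable (A k)) -> (forall k, k \in ks -> pr P (A k) <= c) ->
  measurable (\big[setU/set0]_(k <- ks) A k) /\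
  pr P (\big[setU/set0]_(k <- ks) A k) <= (size ks)%:R * c.
Proof.
move=> mA; elim: ks => [|k ks IHks] Ac.
  by rewrite big_nil /pr measure0 mul0r; split.
have [|mU IH] := IHks; first by move=> k' k'ks; apply: Ac; rewrite in_cons k'ks orbT.
rewrite big_cons; split; first exact: measurableU.
apply: le_trans (pr_setU P _ _ (mA k) mU) _.
by rewrite [size _]/= -natr1 mulrDl mul1r addrC lerD// Ac// mem_head.
Qed.

Lemma hits_blocks (B : nat -> set Omega) s m k om :
  (forall j, (j < k)%N -> exists2 t, (s + j * m <= t < s + j.+1 * m)%N & B t om) ->
  (k <= hits B s (k * m) om)%N.
Proof.
elim: k => // k IH hB; rewrite /hits mulSn addnCA addnC -[(_ + m)%N]addnA.
rewrite (@big_cat_nat _ _ _ (s + k * m))/= ?leq_addr//; last first.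
  by rewrite addnA leq_addr.
rewrite -[X in (X <= _)%N]addn1; apply: leq_add.
  by apply: IH => j jk; apply: hB; exact: ltnW.
have [t /andP[st tk] Bt] := hB k (ltnSn k).
rewrite (@big_cat_nat _ _ _ t)//=; last by rewrite addnA ltnW// -addnA -mulSnr.
rewrite [X in (_ + X)%N]big_ltn; last by rewrite -mulSnr.
by rewrite mem_set//= addnCA leq_addr.
Qed.

End Misses.

(** * The concrete filtration: small-ball and independence estimates *)

Section Filtration.
Context {R : realType} {d : measure_display} {Omega : measurableType d}.
Variables (P : probability Omega R) (nx nz : nat).
Variables (w : nat -> Omega -> 'cV[R]_nx) (z : nat -> Omega -> 'cV[R]_nz).
Hypothesis rw : forall t, random_vector (w t).
Hypothesis rz : forall t, random_vector (z t).

Lemma sigma_of_preimage n (X : Omega -> 'cV[R]_n) B :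
  borel B -> sigma_of X (X @^-1` B).
Proof. by move=> bB; exists B => //; rewrite setTI. Qed.

Lemma filtration_z s t B : (s <= t)%N -> borel B -> filtration w z t (z s @^-1` B).
Proof.
move=> st bB; apply: sub_sigma_algebra; right; exists s => //.
exact: sigma_of_preimage.
Qed.

Lemma filtration_w s t B : (s < t)%N -> borel B -> filtration w z t (w s @^-1` B).
Proof.
move=> st bB; apply: sub_sigma_algebra; left; exists s => //.
exact: sigma_of_preimage.
Qed.

Lemma filtration_measurable t A : filtration w z t A -> measurable A.
Proof.
move: A; apply: smallest_sub; first exact: sigma_algebra_measurable.
move=> A [[s _ [B bB <-]]|[s _ [B bB <-]]]; rewrite setTI; first exact: rw.
exact: rz.
Qed.

Lemma filtration_setC t A : filtration w z t A -> filtration w z t (~` A).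
Proof. exact: sigma_algebraC. Qed.

Lemma filtration_setI t A B :
  filtration w z t A -> filtration w z t B -> filtration w z t (A `&` B).
Proof.
move=> FA FB; rewrite -(setCK (A `&` B)) setCI; apply: filtration_setC.
rewrite -bigcup2E; apply: sigma_algebra_bigcup => -[|[|i]] /=.
- exact: filtration_setC.
- exact: filtration_setC.
- exact: sigma_algebra0.
Qed.

Lemma filtration_mono t A : filtration w z t A -> filtration w z t.+1 A.
Proof.
move: A; apply: sub_sigma_algebra2 => A [[s st ?]|[s st ?]]; [left|right];
  by exists s => //=; exact: leqW.
Qed.

Lemma filtration_exists (K : eqType) (Q : K -> set Omega) (ks : seq K) t :
  (forall k, filtration w z t (Q k)) ->
  filtration w z t [set om | exists2 k, k \in ks & Q k om].
Proof.
move=> FQ; elim: ks => [|k ks IH].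
  rewrite (_ : [set _ | _] = set0); first exact: sigma_algebra0.
  by rewrite -subset0 => om [].
rewrite (_ : [set _ | _] =
    ~` (~` Q k `&` ~` [set om | exists2 k', k' \in ks & Q k' om])).
  apply: filtration_setC; apply: filtration_setI; first exact: filtration_setC.
  exact: filtration_setC.
rewrite setCI !setCK; apply/seteqP; split => om /=.
  by move=> [k']; rewrite in_cons => /orP[/eqP->|]; [left|right; exists k'].
move=> [Qk|[k' k'ks Qk']]; first by exists k => //; exact: mem_head.
by exists k' => //; rewrite in_cons k'ks orbT.
Qed.

(** The set C where p <= Y belongs to the filtration and has full measure, so Y may be integrated
    over A intersected with C, where the bound holds everywhere. *)
Lemma BMSB_step sigma p : 0 < p -> BMSB P w z sigma p ->
  forall u : 'cV[R]_nz, norm2 u = 1 -> forall t A, (1 <= t)%N ->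
  filtration w z t A ->
  p * pr P A <= pr P (A `&` [set om | sigma <= `|dot u (z t.+1 om)|]).
Proof.
move=> p0 bmsb u u1 t A t1 FA; have [Y [FY iY YE] pY] := bmsb u u1 t t1.
set B := [set om | _].
have mB : measurable B.
  exact: (rz t.+1 _ (borel_closed _ _ (closed_abs_dot_ge _ u sigma))).
pose C := [set om | p <= Y om].
have FC : filtration w z t C.
  rewrite (_ : C = Y @^-1` `[p, +oo[).
    by apply: FY; exact: measurable_itv.
  by apply/seteqP; split => om; rewrite /C/= in_itv/= andbT.
have mC := filtration_measurable _ _ FC; have mA := filtration_measurable _ _ FA.
have FAC := filtration_setI _ _ _ FA FC; have mAC := filtration_measurable _ _ FAC.
have AC0 : pr P (A `&` ~` C) = 0.
  rewrite /pr (measure_negligible (measurableI _ _ mA (measurableC mC)))//.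
  by apply: negligibleS pY => om [].
rewrite (pr_split P A C)// AC0 addr0.
apply: (@le_trans _ _ (pr P (A `&` C `&` B))); last first.
  apply: pr_le; [exact: measurableI|exact: measurableI|].
  by move=> om [[]].
rewrite -lee_fin -prE; last exact: measurableI.
rewrite -YE// EFinM -prE// -integral_cst//.
apply: ge0_le_integral => //.
- by move=> om _; rewrite lee_fin ltW.
- have /measurable_int := iY; exact: measurable_funS.
- by move=> om [_]; rewrite lee_fin.
Qed.

(** Otherwise |u . z_2| >= sigma would be a null event by Cauchy-Schwarz, although the small-ball
    condition gives it probability at least p. Time 2 is the first one this condition covers. *)
Lemma BMSB_sigma_le sigma p b : (0 < nz)%N -> 0 < p -> BMSB P w z sigma p ->
  (forall t, {ae P, forall om, norm2 (z t om) <= b}) -> sigma <= b.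
Proof.
move=> nz0 p0 bmsb zb; have [u u1] := exists_unit_vector (R := R) nz nz0.
rewrite leNgt; apply/negP => bs.
have FT : filtration w z 1 setT.
  by rewrite -setC0; apply: filtration_setC; exact: sigma_algebra0.
have := BMSB_step sigma p p0 bmsb u u1 1%N setT (leqnn _) FT.
rewrite setTI pr_setT mulr1.
have mB : measurable [set om | sigma <= `|dot u (z 2 om)|].
  exact: (rz 2 _ (borel_closed _ _ (closed_abs_dot_ge _ u sigma))).
rewrite /pr measure_negligible//; first by rewrite leNgt p0.
apply: negligibleS (zb 2%N) => om /= h zle.
have := dot_le _ u (z 2 om); rewrite u1 mul1r; lra.
Qed.

Lemma independent_miss (S : set 'cV[R]_nx) (q : R) t :
  independent_sigma P (sigma_of (w t)) (filtration w z t) -> borel S ->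
  (q%:E <= P (w t @^-1` S))%E ->
  forall A, filtration w z t A ->
  pr P (A `&` ~` (w t @^-1` S)) <= (1 - q) * pr P A.
Proof.
move=> ind bS qS A FA; have mA := filtration_measurable _ _ FA.
have mS : measurable (w t @^-1` S) by exact: rw.
have mSC := measurableC mS.
have := ind _ _ (sigma_of_preimage _ _ _ (borel_setC _ _ bS)) FA.
rewrite setIC preimage_setC !prE//; last exact: measurableI.
rewrite -EFinM => -[->]; rewrite ler_wpM2r ?pr_ge0//.
move: qS; rewrite prE// lee_fin => qS.
have : 1 = pr P (w t @^-1` S) + pr P (~` (w t @^-1` S)).
  have := pr_split P setT (w t @^-1` S) measurableT mS.
  by rewrite !setTI pr_setT.
by lra.
Qed.

End Filtration.

(** * Numerical constants and the number of blocks *)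

Section Constants.
Context {R : realType}.

Lemma two_le_expR : 2 <= expR (3 / 4) :> R.
Proof.
have h : 9 / 8 <= expR (1 / 8) :> R by apply: le_trans (expR_ge1Dx _); lra.
have -> : 3 / 4 = 6%:R * (1 / 8) :> R by lra.
rewrite expRM_natl; apply: (@le_trans _ _ ((9 / 8) ^+ 6)); first by lra.
by rewrite lerXn2r// nnegrE ?expR_ge0//; lra.
Qed.

(** With 2 <= exp(3/4) and 1 - p/2 <= exp(-p/2), the exponent is at most 3/4 - L p / 8. Rounding r
    up and passing from L to L + 1 cost in all at most a factor e <= 3. *)
Lemma few_hits_const_le (p : R) (L r : nat) : 0 < p <= 1 ->
  r%:R <= L%:R * p / 2 + 1 ->
  2 ^+ r * (1 - p / 2) ^+ L <= 3 * expR (- (1 / 8 * p ^+ 2) * L.+1%:R).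
Proof.
move=> /andP[p0 p1] rL.
have h1 : 2 ^+ r <= expR (3 / 4 * r%:R) :> R.
  by rewrite mulrC expRM_natl lerXn2r// ?nnegrE ?expR_ge0//; exact: two_le_expR.
have h2 : (1 - p / 2) ^+ L <= expR (L%:R * (- (p / 2))).
  rewrite expRM_natl lerXn2r// ?nnegrE ?expR_ge0//; first by lra.
  exact: expR_ge1Dx.
apply: le_trans (_ : expR (3 / 4 * r%:R) * expR (L%:R * (- (p / 2))) <= _).
  by apply: ler_pM => //; rewrite exprn_ge0//; lra.
apply: (@le_trans _ _ (expR 1 * expR (- (1 / 8 * p ^+ 2) * L.+1%:R))).
  rewrite -!expRD ler_expR -natr1.
  have pp : p ^+ 2 <= p by rewrite expr2 ger_pMl.
  have L0 : 0 <= L%:R :> R by [].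
  move: rL L0; set l : R := L%:R; set rr : R := r%:R => rL L0.
  have : l * p ^+ 2 <= l * p by rewrite ler_wpM2l.
  by move=> lp; lra.
by rewrite ler_wpM2r ?expR_ge0//; exact: expR1_le3.
Qed.

Lemma exists_threshold (a : R) : 0 <= a -> exists r : nat, a <= r%:R <= a + 1.
Proof.
move=> a0; exists (Num.truncn a).+1.
have /andP[h1 h2] := truncn_itv a0.
by rewrite (ltW h2)/= -natr1 lerD2r.
Qed.

(** The right side is the number of full blocks of length m among the instants 1, ..., T - 1. *)
Lemma ceil_div_pred (T m : nat) : (0 < m)%N -> (0 < T)%N ->
  Num.ceil (T%:R / m%:R : R) - 1 = Posz (T.-1 %/ m)%N.
Proof.
move=> m0 T0; have mR : 0 < m%:R :> R by rewrite ltr0n.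
apply/eqP; rewrite subr_eq; apply/eqP/ceil_def.
have -> : Posz (T.-1 %/ m)%N + 1 - 1 = Posz (T.-1 %/ m)%N by rewrite addrK.
rewrite intrD -!pmulrn natr1 ltr_pdivlMr// ler_pdivrMr// -!natrM.
rewrite ltr_nat ler_nat; apply/andP; split.
  by rewrite -[ltnRHS](prednK T0) ltnS leq_trunc_div.
by rewrite -[leqLHS](prednK T0) ltn_ceil.
Qed.

End Constants.

(** * Exclusion of the slice at one instant, and sizes of the two nets *)

Section Slices.
Context {R : realType}.

(** If [wt] were in the slice, feasibility would force h . (G zeta) <= a delta / 4. But G / |G| is
    [rho *: Y] up to an error of effect at most 5a/4, with rho >= 9/10, so h . (G zeta) > |G| a / 2
    > a delta / 4. *)
Lemma not_in_slice (nx nz : nat) (W : set 'cV[R]_nx) (c h wt : 'cV[R]_nx)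
    (G Y : 'M[R]_(nx, nz)) (zeta : 'cV[R]_nz) (rho a b delta : R) :
  supporting W c h -> 0 < a -> 4 * a <= b -> 0 < delta ->
  norm2 zeta <= b -> delta / 2 < norm2 G ->
  1 - (5 * a / (4 * b)) ^+ 2 <= rho ->
  norm2 ((norm2 G)^-1 *: G - rho *: Y) <= 5 * a / (4 * b) ->
  2 * a <= dot h (Y *m zeta) -> W (wt - G *m zeta) ->
  ~ slice W (a * delta / 4) c h wt.
Proof.
move=> [_ h1 Wch] a0 ab d0 zb dG rv GY hY WG [/= /andP[_ hw] _].
have b0 : 0 < b by lra.
set v := 5 * a / (4 * b) in rv GY.
have vb : v * b = 5 / 4 * a by rewrite /v; field; rewrite gt_eqF.
have v0 : 0 <= v by rewrite divr_ge0//; lra.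
have v516 : v <= 5 / 16 by rewrite /v ler_pdivrMr; lra.
have G0 : 0 < norm2 G by lra.
have := Wch _ WG; rewrite /halfspace/= dotBr => hc.
have hG : dot h (G *m zeta) <= a * delta / 4 by lra.
have E : dot h (G *m zeta) = norm2 G *
    (rho * dot h (Y *m zeta) + dot h (((norm2 G)^-1 *: G - rho *: Y) *m zeta)).
  rewrite -dotZr -dotDr -dotZr mulmxBl -!scalemxAl addrC subrK scalerA.
  by rewrite divff ?gt_eqF// scale1r.
have := dot_mulmx_le _ _ h ((norm2 G)^-1 *: G - rho *: Y) zeta.
rewrite h1 mul1r ler_norml => /andP[hl _].
have hvb : norm2 ((norm2 G)^-1 *: G - rho *: Y) * norm2 zeta <= 5 / 4 * a.
  by rewrite -vb; apply: ler_pM => //; exact: norm2_ge0.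
have rho9 : 9 / 10 <= rho by apply: le_trans rv; nra.
have hY2 : 9 / 10 * (2 * a) <= rho * dot h (Y *m zeta).
  by apply: ler_pM => //; lra.
have lo : a / 2 < rho * dot h (Y *m zeta) +
    dot h (((norm2 G)^-1 *: G - rho *: Y) *m zeta) by lra.
have : delta / 2 * (a / 2) < dot h (G *m zeta).
  by rewrite E; apply: ltr_pM => //; lra.
by lra.
Qed.

(** In terms of t = b / (sigma p) >= 1 this is 6 + 48 t <= 64 t^2. *)
Lemma net_size_vector (sigma p b : R) : 0 < sigma -> 0 < p <= 1 -> sigma <= b ->
  6 + 3 / (sigma * p / (16 * b)) <=
  Num.max 1 (64 * b ^+ 2 / (sigma ^+ 2 * p ^+ 2)).
Proof.
move=> s0 /andP[p0 p1] sb; rewrite le_max; apply/orP; right.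
have b0 : 0 < b by lra.
have sp0 : 0 < sigma * p by rewrite mulr_gt0.
have spb : sigma * p <= b by apply: le_trans sb; rewrite ger_pMr.
set t := b / (sigma * p).
have t1 : 1 <= t by rewrite ler_pdivlMr// mul1r.
have -> : 3 / (sigma * p / (16 * b)) = 48 * t.
  by rewrite /t; field; rewrite !gt_eqF.
have -> : 64 * b ^+ 2 / (sigma ^+ 2 * p ^+ 2) = 64 * t ^+ 2.
  by rewrite /t; field; rewrite !gt_eqF.
nra.
Qed.

(** In terms of t = b / a >= 4 this is 6 + 12 t / 5 <= 4 t. *)
Lemma net_size_matrix (a b : R) : 0 < a -> 4 * a <= b ->
  6 + 3 / (5 * a / (4 * b)) <= Num.max 1 (4 * b / a).
Proof.
move=> a0 ab; rewrite le_max; apply/orP; right.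
have b0 : 0 < b by lra.
set t := b / a; have t4 : 4 <= t by rewrite ler_pdivlMr.
have -> : 3 / (5 * a / (4 * b)) = 12 / 5 * t.
  by rewrite /t; field; rewrite !gt_eqF.
have -> : 4 * b / a = 4 * t by rewrite /t; field; rewrite gt_eqF.
by lra.
Qed.

End Slices.

(** * The probability bound for the system *)

Section Bound.
Context {R : realType} {d : measure_display} {Omega : measurableType d}.
Variables (P : probability Omega R) (nx nu : nat).
Variables (theta_star : 'M[R]_(nx, nx + nu)).
Variables (x : nat -> Omega -> 'cV[R]_nx) (u : nat -> Omega -> 'cV[R]_nu).
Variables (w : nat -> Omega -> 'cV[R]_nx) (W : set 'cV[R]_nx).
Variables (b_z sigma_z p_z : R).
Variables (I : Type) (c h : I -> 'cV[R]_nx) (p_w : R -> R).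
Let z := regressor x u.
Let nz := (nx + nu)%N.
Hypothesis nx0 : (0 < nx)%N.
Hypothesis rx : forall t, random_vector (x t).
Hypothesis ru : forall t, random_vector (u t).
Hypothesis rw : forall t, random_vector (w t).
Hypothesis dyn : forall t om, x t.+1 om = theta_star *m z t om + w t om.
Hypothesis indep :
  forall t, independent_sigma P (sigma_of (w t)) (filtration w z t).
Hypothesis W_compact : compact W.
Hypothesis W_interior : interior W !=set0.
Hypothesis excit : bounded_BMSB P w z b_z sigma_z p_z.
Hypothesis visit : slice_visiting_noise P W w c h p_w.

Let sg0 : 0 < sigma_z := excit_sigma excit.
Let p01 : 0 < p_z <= 1 := excit_p excit.
Let p0 : 0 < p_z. Proof. by have /andP[] := p01. Qed.
Let p1 : p_z <= 1. Proof. by have /andP[] := p01. Qed.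
Let zb := excit_bounded excit.
Let supp := visit_supporting visit.
Let nz0 : (0 < nz)%N. Proof. by rewrite addn_gt0 nx0. Qed.

Let rz t : random_vector (z t).
Proof. exact: random_vector_col_mx. Qed.

Let Fm := filtration_measurable nx nz w z rw rz.
Let FI := @filtration_setI R d Omega nx nz w z.
Let FC := @filtration_setC R d Omega nx nz w z.
Let FS := @filtration_mono R d Omega nx nz w z.

Let sb : sigma_z <= b_z.
Proof. exact: BMSB_sigma_le P nx nz w z rw rz sigma_z p_z b_z nz0 p0 (excit_BMSB excit) zb. Qed.

Let xi := minmax_dot h.
Let xi0 : 0 < xi := minmax_dot_gt0 nx W I c h nx0 W_interior supp (visit_compact visit).
Let xi1 : xi <= 1 := minmax_dot_le1 nx W I c h nx0 W_interior supp (visit_compact visit).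
(** The product of the constants [a1] and [xi] of the theorem. *)
Let a := 1 / 4 * sigma_z * p_z * xi.

Let a0 : 0 < a. Proof. by rewrite /a !mulr_gt0. Qed.
Let ab : 4 * a <= b_z.
Proof.
have -> : 4 * a = sigma_z * p_z * xi by rewrite /a; field.
apply: le_trans sb; rewrite -mulrA ger_pMr// mulr_ile1// ?ltW//.
Qed.

(** * Events for a fixed horizon, block length and accuracy *)

Section Horizon.
Variables (T m : nat) (delta : R).
Hypothesis m0 : (0 < m)%N.
Hypothesis mT : (m < T)%N.
Hypothesis d0 : 0 < delta.

Let k := (T.-1 %/ m)%N.
Let L := m.-1.
Let eps := a * delta / 4.
Let eps0 : 0 < eps. Proof. by rewrite divr_gt0// mulr_gt0. Qed.

Let T0 : (0 < T)%N. Proof. exact: leq_ltn_trans mT. Qed.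

Let kmT : (k * m < T)%N.
Proof. by rewrite -[ltnRHS](prednK T0) ltnS leq_trunc_div. Qed.

Let hit (y : 'cV[R]_nz) t : set Omega := [set om | sigma_z <= `|dot y (z t om)|].

(* Only the last m - 1 instants of the j-th block jm+1, ..., jm+m are used:
   the small-ball condition says nothing about z_1. *)
Let few (r : nat) (jy : nat * 'cV[R]_nz) : set Omega :=
  [set om | (hits (hit jy.2) (jy.1 * m).+2 L om < r)%N].

(** [push] and [pushed] are known at time t, [touch] and [missed] only at t + 1. As [missed]
    concerns every pushed direction, none has to be selected. *)
Let push N (f : 'I_N -> I) (Y : 'M[R]_(nx, nz)) t i : set Omega :=
  [set om | 2 * a <= dot (h (f i)) (Y *m z t om)].
Let pushed N (f : 'I_N -> I) (Y : 'M[R]_(nx, nz)) t : set Omega :=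
  [set om | exists2 i, i \in enum 'I_N & push N f Y t i om].
Let touch N (f : 'I_N -> I) t i : set Omega :=
  w t @^-1` slice W eps (c (f i)) (h (f i)).
Let missed N (f : 'I_N -> I) (Y : 'M[R]_(nx, nz)) t : set Omega :=
  [set om | forall i, i \in enum 'I_N -> push N f Y t i om -> ~ touch N f t i om].

Let F_hit y t : filtration w z t (hit y t).
Proof.
exact: (filtration_z _ _ w z _ _ _ (leqnn t)
  (borel_closed _ _ (closed_abs_dot_ge _ y sigma_z))).
Qed.

Let F_push N f Y t i : filtration w z t (push N f Y t i).
Proof.
have -> : push N f Y t i =
    z t @^-1` [set v | 2 * a <= dot (Y^T *m h (f i)) v].
  apply/seteqP; split => om; rewrite /push /= /dot trmx_mul trmxK mulmxA//.
apply: (filtration_z _ _ w z) => //; apply: borel_closed; exact: closed_dot_ge.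
Qed.

Let F_pushed N f Y t : filtration w z t (pushed N f Y t).
Proof. by apply: filtration_exists. Qed.

Let slice_borel i : borel (slice W eps (c i) (h i)).
Proof.
apply: borel_closed; apply: closed_slice.
by apply: compact_closed W_compact; exact: norm_hausdorff.
Qed.

Let F_touch N f t i : filtration w z t.+1 (touch N f t i).
Proof. exact: filtration_w. Qed.

Let F_missed N f Y t : filtration w z t.+1 (missed N f Y t).
Proof.
have -> : missed N f Y t = ~` [set om | exists2 i, i \in enum 'I_N &
    (push N f Y t i `&` touch N f t i) om].
  apply/seteqP; split => om /=.
    by move=> hm [i ie [pi ti]]; exact: (hm i ie pi).
  by move=> hm i ie pi ti; apply: hm; exists i.
apply: FC; apply: filtration_exists => i; apply: FI => //.
by apply: FS; exact: F_push.
Qed.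

Let pw_le1 : 0 <= 1 - p_w eps <= 1.
Proof.
have pw0 := visit_pw_gt0 visit eps0.
have [y y1] := exists_unit_vector (R := R) nx nx0.
have [i _] := minmax_dot_lt nx W I c h nx0 W_interior supp (visit_compact visit)
  y 1 y1 ltr01.
have := visit_prob visit eps0 0 i.
have mS : measurable (w 0 @^-1` slice W eps (c i) (h i)) by exact: rw.
rewrite (prE P _ mS) lee_fin => hp; have := pr_le1 P _ mS; lra.
Qed.

(** The one-step hypothesis of [surviving_le] is [misses_le], fed with the independence of w_t from
    the past and the lower bound on the slice probabilities. *)
Lemma pr_surviving_le N f Y :
  pr P (surviving (pushed N f Y) (missed N f Y) 1 (k * m) k) <=
  (1 - p_w eps) ^+ k.
Proof.
have FT : filtration w z 1 setT.
  by rewrite -setC0; apply: filtration_setC; exact: sigma_algebra0.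
have := surviving_le P (filtration w z) Fm FI FC FS (pushed N f Y) (missed N f Y)
  (1 - p_w eps) pw_le1 (F_pushed N f Y) (F_missed N f Y).
move=> /(_ _ (k * m)%N 1%N k setT FT); rewrite setTI pr_setT mulr1.
apply=> t A FA Asub.
apply: (misses_le P (filtration w z t) _ (push N f Y t) (touch N f t)) => //.
- exact: Fm.
- exact: FI.
- exact: FC.
- by move=> i; exact: rw.
move=> i B FB; exact: (independent_miss P nx nz w z rw rz _ (p_w eps) t (indep t)
  (slice_borel (f i)) (visit_prob visit eps0 t (f i))).
Qed.

Lemma pr_few_le r j y : norm2 y = 1 -> r%:R <= L%:R * p_z / 2 + 1 ->
  pr P (few r (j, y)) <= 3 * expR (- (1 / 8 * p_z ^+ 2) * m%:R).
Proof.
move=> y1 rL.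
have FT : filtration w z (j * m).+1 setT.
  by rewrite -setC0; apply: filtration_setC; exact: sigma_algebra0.
(* Conditioning starts at time jm + 1 >= 1 and counting at jm + 2, so the small-ball condition
   applies to every counted instant. *)
have := few_hits_le P (filtration w z) Fm FI FC FS (hit y) p_z 1%N p1 (F_hit y).
move=> /(_ _ L (j * m).+1 r setT isT FT).
rewrite setTI pr_setT mulr1 => few_le.
apply: le_trans (few_le _) _.
  move=> t A t1 FA.
  exact: (BMSB_step P nx nz w z rw rz sigma_z p_z p0 (excit_BMSB excit)).
by have := few_hits_const_le p_z L r p01 rL; rewrite /L prednK.
Qed.

(** The deterministic part, for one outcome. The condition m > 1 keeps the blocks nonempty after
    their first instant is dropped. *)
Lemma large_diam_surviving N (f : 'I_N -> I) (r : nat)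
    (S1 : seq 'cV[R]_nz) (S2 : seq 'M[R]_(nx, nz)) om :
  (forall y : 'cV[R]_nx, exists i, 4 / 5 * xi * norm2 y <= dot (h (f i)) y) ->
  (forall X : 'cV[R]_nz, norm2 X = 1 -> exists2 U, U \in S1 & exists rho : R,
    [/\ 0 < rho <= 1, 1 - (sigma_z * p_z / (16 * b_z)) ^+ 2 <= rho &
        norm2 (X - rho *: U) <= sigma_z * p_z / (16 * b_z)]) ->
  (forall U, U \in S2 -> norm2 U = 1) ->
  (forall X : 'M[R]_(nx, nz), norm2 X = 1 -> exists2 U, U \in S2 & exists rho : R,
    [/\ 0 < rho <= 1, 1 - (5 * a / (4 * b_z)) ^+ 2 <= rho &
        norm2 (X - rho *: U) <= 5 * a / (4 * b_z)]) ->
  (1 < m)%N -> L%:R * p_z / 2 <= r%:R ->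
  (forall t, (t < T)%N -> norm2 (z t om) <= b_z) ->
  (forall j y, (j < k)%N -> y \in S1 -> ~ few r (j, y) om) ->
  (delta%:E < diam (membership_set W x u T om))%E ->
  exists2 Y, Y \in S2 &
    surviving (pushed N f Y) (missed N f Y) 1 (k * m) k om.
Proof.
move=> dirs net1 S2unit net2 m2 rL zbd nofew /ereal_sup_gt[_ [[th1 th2] /= [h1 h2] <-]].
rewrite lte_fin => dth.
have [th [thM thd]] : exists th, membership_set W x u T om th /\
    delta / 2 < norm2 (th - theta_star).
  have [l|l] := ltP (delta / 2) (norm2 (th1 - theta_star)); first by exists th1.
  exists th2; split => //.
  have := norm2D _ _ (th1 - theta_star) (- (th2 - theta_star)).
  rewrite norm2N opprB addrA subrK; lra.
set G := th - theta_star in thd.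
have G0 : 0 < norm2 G by apply: lt_trans thd; rewrite divr_gt0.
have [|Y YS2 [rho [_ rv GY]]] := net2 ((norm2 G)^-1 *: G).
  by rewrite norm2Z gtr0_norm ?invr_gt0// mulVf ?gt_eqF.
exists Y => //; split.
  apply: hits_blocks => j jk.
  have jmT : (j * m + m <= k * m)%N by rewrite -mulSnr leq_mul2r jk orbT.
  have blk t : ((j * m).+2 <= t < (j * m).+2 + L)%N ->
      (1 + j * m <= t < 1 + j.+1 * m)%N.
    move=> /andP[t1 t2]; rewrite add1n (ltnW t1)/=; apply: leq_trans t2 _.
    by rewrite addSnnS /L prednK// mulSnr addSn add1n.
  have zblk t : ((j * m).+2 <= t < (j * m).+2 + L)%N -> norm2 (z t om) <= b_z.
    move=> /blk/andP[_]; rewrite add1n ltnS mulSnr => tj.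
    by apply: zbd; apply: leq_ltn_trans kmT; exact: leq_trans jmT.
  have many y : y \in S1 -> (r <= \sum_((j * m).+2 <= t < (j * m).+2 + L)
      (sigma_z <= `|dot y (z t om)|)%R)%N.
    move=> yS1; have := nofew j y jk yS1; rewrite /few/= => /negP.
    rewrite -leqNgt => /leq_trans; apply; rewrite /hits; apply: leq_sum => t _.
    by case: (boolP (om \in hit y t)) => // /set_mem /= ->.
  have L0 : (0 < L)%N by rewrite /L -ltnS prednK.
  have [t tb Yt] := excitation_matrix nx nz sigma_z p_z b_z (j * m).+2 L r
    (fun t => z t om) S1 Y sg0 p01 sb zblk net1 rL many L0 (S2unit Y YS2).
  exists t; first exact: blk.
  have [i hi] := dirs (Y *m z t om); exists i; first by rewrite mem_enum.
  rewrite /push/=; apply: le_trans hi.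
  (* The two losses combine to 4/5 times 5/8 = 1/2, exactly the threshold 2 [a]. *)
  apply: le_trans (_ : 4 / 5 * xi * (5 / 8 * sigma_z * p_z) <= _).
    by rewrite le_eqVlt; apply/orP; left; apply/eqP; rewrite /a; field.
  by rewrite ler_pM2l// mulr_gt0.
move=> t /andP[_ tk] _ i _ hpush; rewrite /touch/= /eps.
have tT : (t < T)%N by apply: leq_trans kmT; rewrite ltnS -ltnS -add1n.
apply: (not_in_slice _ _ W (c (f i)) (h (f i)) (w t om) G Y (z t om) rho a b_z)
  => //; first exact: zbd.
have := thM t tT; rewrite dyn /G mulmxBl opprB.
by rewrite addrCA addrA.
Qed.

Lemma pr_diam_gt_le :
  (P [set om | delta%:E < diam (membership_set W x u T om)] <=
   (T%:R / m%:R * 3 * Num.max 1 (64 * b_z ^+ 2 / (sigma_z ^+ 2 * p_z ^+ 2)) ^+ nz *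
      expR (- (1 / 8 * p_z ^+ 2) * m%:R)
    + Num.max 1 (4 * b_z / a) ^+ (nx * nz) * (1 - p_w eps) ^+ k)%:E)%E.
Proof.
have b0 : 0 < b_z by exact: lt_le_trans sb.
have sp0 : 0 < sigma_z * p_z by rewrite mulr_gt0.
have [N [f dirs]] := finite_directions nx W I c h nx0 W_interior supp
  (visit_compact visit).
have v1 : 0 < sigma_z * p_z / (16 * b_z) < 1.
  rewrite divr_gt0 ?mulr_gt0//= ltr_pdivrMr ?mulr_gt0// mul1r.
  have : sigma_z * p_z <= b_z by apply: le_trans sb; rewrite ger_pMr.
  by lra.
have v2 : 0 < 5 * a / (4 * b_z) < 1.
  by rewrite divr_gt0 ?mulr_gt0//= ltr_pdivrMr ?mulr_gt0//; have := ab; lra.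
have [S1 [S1size S1unit net1]] := sphere_net_mx nz 1 _ v1.
have [S2 [S2size S2unit net2]] := sphere_net_mx nx nz _ v2.
have [r /andP[rL rU]] : exists r : nat, L%:R * p_z / 2 <= r%:R <= L%:R * p_z / 2 + 1.
  by apply: exists_threshold; rewrite divr_ge0// mulr_ge0// ltW.
(* Measurable null sets containing the outcomes where z_t violates its bound; the T first ones join
   the union bound at no cost. *)
have /choice[Nt NtP] : forall t, exists B, [/\ measurable B, P B = 0 &
    ~` [set om | norm2 (z t om) <= b_z] `<=` B].
  by move=> t; have [B [mB PB sB]] := zb t; exists B.
pose js := [seq (j, y) | j <- iota 0 k, y <- S1].
set A := [set om | _].
have mA : measurable A.
  exact: (measurable_diam_gt d Omega nx nz T W (fun t => x t.+1) z delta W_compact).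
have pwk : 0 <= (1 - p_w eps) ^+ k.
  by rewrite exprn_ge0//; have /andP[] := pw_le1.
have max1 (y : R) : 0 <= Num.max 1 y by rewrite le_max ler01.
(* For m = 1 the shortened blocks are empty, but the first term is then at least 3/2 and the claim
   is trivial. *)
have [m1|m2] := leqP m 1.
  apply: le_trans (probability_le1 P mA) _; rewrite lee_fin.
  apply: ler_wpDr; first by rewrite mulr_ge0// exprn_ge0.
  have -> : m = 1%N by apply/eqP; rewrite eqn_leq m1.
  rewrite divr1 mulr1.
  have e1 : 1 / 2 <= expR (- (1 / 8 * p_z ^+ 2)).
    apply: le_trans (expR_ge1Dx _).
    have : p_z ^+ 2 <= 1 by rewrite expr_le1// ltW.
    by lra.
  have T1 : 1 <= T%:R :> R by rewrite ler1n.
  have M1 : 1 <= Num.max 1 (64 * b_z ^+ 2 / (sigma_z ^+ 2 * p_z ^+ 2)) ^+ nz.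
    by rewrite exprn_ege1// le_max lexx.
  move: e1 T1 M1; set e := expR _; set t : R := T%:R; set M := _ ^+ nz => e1 T1 M1.
  have tM : 1 <= t * M by rewrite -[leLHS]mulr1 ler_pM.
  have -> : t * 3 * M * e = 3 * (t * M * e) by ring.
  have : 1 * (1 / 2) <= t * M * e by apply: ler_pM => //; lra.
  by lra.
have mNt t : measurable (Nt t) by have [] := NtP t.
have [|mN prN] := pr_bigsetU_le P nat (iota 0 T) Nt 0 mNt.
  by move=> t _; have [_ PB _] := NtP t; rewrite /pr PB.
have mfew jy : measurable (few r jy).
  by apply: measurable_hits_lt => t; exact: Fm (F_hit _ _).
have [|mF prF] := pr_bigsetU_le P _ js (few r)
    (3 * expR (- (1 / 8 * p_z ^+ 2) * m%:R)) mfew.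
  by move=> [j y] /allpairsP[[j' y'] /= [_ yS [-> ->]]]; apply: pr_few_le => //; exact: S1unit.
have mS Y : measurable (surviving (pushed N f Y) (missed N f Y) 1 (k * m) k).
  by apply: measurable_surviving => t; [exact: Fm (F_pushed _ _ _ _)|exact: Fm (F_missed _ _ _ _)].
have [|mD prD] := pr_bigsetU_le P _ S2
    (fun Y => surviving (pushed N f Y) (missed N f Y) 1 (k * m) k)
    ((1 - p_w eps) ^+ k) mS.
  by move=> Y _; exact: pr_surviving_le.
move: mN prN mF prF mD prD; set BN := \big[_/_]_(t <- _) _.
set BF := \big[_/_]_(t <- _) _; set BD := \big[_/_]_(t <- _) _.
move=> mN prN mF prF mD prD.
have AB : A `<=` BN `|` BF `|` BD.
  move=> om Aom; have [BNom|nBN] := pselect (BN om); first by left; left.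
  have [BFom|nBF] := pselect (BF om); first by left; right.
  right; have [||Y YS sY] := large_diam_surviving N f r S1 S2 om dirs net1 S2unit
      net2 m2 rL _ _ Aom.
  - move=> t tT; apply: contrapT => zt; apply: nBN; rewrite /BN -bigcup_seq.
    exists t => /=; first by rewrite mem_iota.
    by have [_ _] := NtP t; apply.
  - move=> j y jk yS1 fy; apply: nBF; rewrite /BF -bigcup_seq; exists (j, y) => //=.
    by apply/allpairsP; exists (j, y); split => //; rewrite mem_iota.
  - by rewrite /BD -bigcup_seq; exists Y.
rewrite prE// lee_fin; apply: le_trans (pr_le P _ _ mA _ AB) _.
  by apply: measurableU => //; exact: measurableU.
apply: le_trans (pr_setU P _ _ (measurableU _ _ mN mF) mD) _.
apply: lerD.
  apply: le_trans (pr_setU P _ _ mN mF) _.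
  rewrite -[leRHS]add0r; apply: lerD; first by rewrite -(mulr0 (size (iota 0 T))%:R).
  apply: le_trans prF _; rewrite size_allpairs size_iota natrM.
  have -> : T%:R / m%:R * 3 * Num.max 1 (64 * b_z ^+ 2 / (sigma_z ^+ 2 * p_z ^+ 2)) ^+ nz
      * expR (- (1 / 8 * p_z ^+ 2) * m%:R) =
      T%:R / m%:R * Num.max 1 (64 * b_z ^+ 2 / (sigma_z ^+ 2 * p_z ^+ 2)) ^+ nz *
      (3 * expR (- (1 / 8 * p_z ^+ 2) * m%:R)) by ring.
  rewrite ler_wpM2r ?mulr_ge0 ?expR_ge0//; apply: ler_pM => //.
    (* The number of blocks k is at most T/m. *)
    by rewrite ler_pdivlMr ?ltr0n// -natrM ler_nat ltnW.
  apply: le_trans S1size _; rewrite muln1 lerXn2r// ?nnegrE.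
  - by rewrite addr_ge0// divr_ge0//; have /andP[/ltW] := v1.
  - by rewrite le_max ler01.
  - exact: net_size_vector.
apply: le_trans prD _; apply: ler_wpM2r.
  by rewrite exprn_ge0//; have /andP[] := pw_le1.
apply: le_trans S2size _; rewrite lerXn2r// ?nnegrE.
- by rewrite addr_ge0// divr_ge0//; have /andP[/ltW] := v2.
- by rewrite le_max ler01.
- exact: net_size_matrix.
Qed.

End Horizon.
End Bound.

(** * Soft-O factors and conclusion *)

Lemma soft_bigO_cst (R : realType) (c a : R) : 0 <= a ->
  soft_bigO (fun=> c) (fun n : nat => (n%:R : R) `^ a).
Proof.
move=> a0; exists 0%N; apply/eqOP.
exists `|c|; split; first exact: num_real.
move=> k ck /=; exists 1%N => // n /= n1.
rewrite expr0 mulr1 [X in _ * X](ger0_norm (powR_ge0 _ _)).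
apply: le_trans (ltW ck) _; rewrite ler_peMr//.
  by apply: le_trans (ltW ck).
rewrite -[leLHS](powRr0 n%:R); apply: ler_powR => //.
by rewrite ler1n.
Qed.

Theorem theorem2 (R : realType) :
  exists f g : nat -> R,
  [/\ soft_bigO f (fun n : nat => (n%:R : R) `^ (5 / 2)),
      soft_bigO g (fun n : nat => (n%:R : R) `^ (5 / 2))
    & forall (d : measure_display) (Omega : measurableType d)
        (P : probability Omega R) (nx nu : nat)
        (theta_star : 'M[R]_(nx, nx + nu))
        (x : nat -> Omega -> 'cV[R]_nx) (u : nat -> Omega -> 'cV[R]_nu)
        (w : nat -> Omega -> 'cV[R]_nx)
        (W : set 'cV[R]_nx) (Sigma_w : 'M[R]_nx) (b_z sigma_z p_z : R)
        (I : Type) (c h : I -> 'cV[R]_nx) (p_w : R -> R),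
      let z := regressor x u in
      let nz := (nx + nu)%N in
      (0 < nx)%N ->
      (forall t, random_vector (x t)) ->
      (forall t, random_vector (u t)) ->
      (forall t, random_vector (w t)) ->
      (forall t om, x t.+1 om = theta_star *m z t om + w t om) ->
      (forall t, independent_sigma P (sigma_of (w t)) (filtration w z t)) ->
      compact_iid_noise P W w Sigma_w ->
      bounded_BMSB P w z b_z sigma_z p_z ->
      slice_visiting_noise P W w c h p_w ->
      let a1 := 1 / 4 * sigma_z * p_z in
      let a2 := Num.max 1 (64 * b_z ^+ 2 / (sigma_z ^+ 2 * p_z ^+ 2)) in
      let a3 := 1 / 8 * p_z ^+ 2 in
      let xi := minmax_dot h in
      let a5 := Num.max 1 (4 * b_z / (a1 * xi)) in
      forall (T m : nat) (delta : R),
      (0 < m)%N -> (m < T)%N -> 0 < delta ->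
      (P [set om | delta%:E < diam (membership_set W x u T om)] <=
       (T%:R / m%:R * f nz * a2 ^+ nz * expR (- a3 * m%:R)
        + g (nx * nz)%N * a5 ^+ (nx * nz)
          * (1 - p_w (a1 * delta * xi / 4))
              ^ (Num.ceil (T%:R / m%:R : R) - 1))%:E)%E].
Proof.
(* The 3 is the prefactor of the Chernoff bound; the net sizes are entirely absorbed by the powers
   of [a2] and [a5]. *)
exists (fun=> 3), (fun=> 1); split; [exact: soft_bigO_cst|exact: soft_bigO_cst|].
move=> d Omega P nx nu theta_star x u w W Sigma_w b_z sigma_z p_z I c h p_w z nz.
move=> nx0 rx ru rw dyn indep noise excit visit a1 a2 a3 xi a5 T m delta m0 mT d0.
have W_compact := noise_compact noise.
have W_interior := noise_interior noise.
have T0 : (0 < T)%N by exact: leq_ltn_trans mT.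
(* The integer exponent is a natural number, so the power becomes an ordinary one. *)
rewrite ceil_div_pred//= mul1r.
rewrite (_ : a1 * delta * xi = a1 * xi * delta); last by rewrite mulrAC.
exact: (pr_diam_gt_le P nx nu theta_star x u w W b_z sigma_z p_z I c h p_w nx0 rx ru
  rw dyn indep W_compact W_interior excit visit T m delta m0 mT d0).
Qed.
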